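(* Let $V_n$ be the real vector space of homogeneous quadratic polynomial maps $\Gamma:\mathbb{C}^n\to\mathbb{C}^n$ with real coefficients satisfying $(x,\Gamma(x))=0$ and $(\Gamma(x),\Gamma(x))=0$ for all $x\in C$, and let $W_n\subset V_n$ be the subspace of maps $x\mapsto\lambda(x)x$ with $\lambda$ a real linear functional. Then: every complete rectifiable bundle of circles $\mathcal S$ in $\mathbb{R}^n$ admits a normalized rectifier; the class of $\Phi_2$ in $V_n/W_n$ (for $\Phi$ a normalized rectifier of $\mathcal S$) is well defined, i.e. $\Phi_2\in V_n$ and its class does not depend on the choice of $\Phi$; and the resulting map $\mathcal S\mapsto[\Phi_2]$ is a bijection from the set of complete rectifiable bundles of circles in $\mathbb{R}^n$ onto $V_n/W_n$.
   Context: A *circle* in $\mathbb{R}^n$ means either a round Euclidean circle or a straight line; $\mathbb{R}^n$ carries the standard Euclidean inner product $(\cdot,\cdot)$, extended to $\mathbb{C}^n$ complex-bilinearly; the *asymptotic cone* is $C=\{x\in\mathbb{C}^n:(x,x)=0\}$. A *simple bundle of circles* in $\mathbb{R}^n$ is a collection of circles all passing through $0$, no two tangent at $0$; it is *rectifiable* if some germ at $0$ of a smooth diffeomorphism $(\mathbb{R}^n,0)\to(\mathbb{R}^n,0)$ maps the germ at $0$ of every circle of the collection into a straight line. It is *complete* if for every line $\ell$ through $0$ there is exactly one circle of the bundle tangent to $\ell$ at $0$. A *normalized rectifier* of a bundle $\mathcal S$ is a germ of smooth diffeomorphism $\Phi:(\mathbb{R}^n,0)\to(\mathbb{R}^n,0)$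 with $d_0\Phi=\mathrm{id}$ such that $\Phi^{-1}$ maps the germ at $0$ of each circle of $\mathcal S$ into a straight line. $\Phi_2$ denotes the homogeneous quadratic part of the Taylor expansion $\Phi(x)=x+\Phi_2(x)+\cdots$, extended to $\mathbb{C}^n$.
   Formalization: V_n is taken as a set and V_n/W_n as the set of classes modulo adding maps λ(x)x; the claim that V_n is a vector space is dropped, as it fails for n=4 (x_0·ix and x_0·xi in quaternions lie in V_4, their sum does not). *)

(* Defs.v *)
From HB Require Import structures.
From mathcomp Require Import all_boot all_order all_algebra.
From mathcomp Require Import all_classical all_reals all_analysis.
From mathcomp Require Import complex.
Set Implicit Arguments. Unset Strict Implicit. Unset Printing Implicit Defensive.
Import Order.TTheory GRing.Theory Num.Theory.
Import numFieldNormedType.Exports.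
Local Open Scope classical_set_scope.
Local Open Scope ring_scope.

Section Defs.
Variables (R : realType) (n : nat).
Local Notation V := 'rV[R]_n.

Definition dotR (x y : V) : R := \sum_(i < n) x 0 i * y 0 i.

Definition dotC (x y : 'rV[R[i]]_n) : R[i] := \sum_(i < n) x 0 i * y 0 i.

Definition asym_cone : set 'rV[R[i]]_n := [set x | dotC x x = 0].

Definition e_ (i : 'I_n) : V := delta_mx 0 i.

Definition is_line (L : set V) : Prop :=
  exists a v : V, v != 0 /\ L = [set a + t *: v | t in [set: R]].

Definition is_round_circle (K : set V) : Prop :=
  exists (c u w : V) (r : R), 0 < r /\ dotR u u = 1 /\ dotR w w = 1 /\
    dotR u w = 0 /\
    K = [set c + (r * cos t) *: u + (r * sin t) *: w | t in [set: R]].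

Definition is_circle (K : set V) : Prop := is_round_circle K \/ is_line K.

Definition parallel (v d : V) : Prop :=
  v != 0 /\ d != 0 /\ exists s : R, v = s *: d.

(** The circle K (passing through 0) is tangent at 0 to the line through 0
    with direction d.  Every round circle through 0 can be parametrised with
    0 = c + r u, and then its tangent direction at 0 is w. *)
Definition tangent_at0 (K : set V) (d : V) : Prop :=
  (exists v : V, K = [set t *: v | t in [set: R]] /\ parallel v d) \/
  (exists (c u w : V) (r : R), 0 < r /\ dotR u u = 1 /\ dotR w w = 1 /\
     dotR u w = 0 /\ c + r *: u = 0 /\
     K = [set c + (r * cos t) *: u + (r * sin t) *: w | t in [set: R]] /\
     parallel w d).

Definition simple_bundle (S : set (set V)) : Prop :=
  (forall K, S K -> is_circle K /\ K 0) /\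
  (forall K1 K2 d, S K1 -> S K2 -> tangent_at0 K1 d -> tangent_at0 K2 d ->
     K1 = K2).

Definition complete_bundle (S : set (set V)) : Prop :=
  forall d : V, d != 0 ->
    exists K, S K /\ tangent_at0 K d /\
      forall K', S K' -> tangent_at0 K' d -> K' = K.

Fixpoint iter_partial (l : seq 'I_n) (f : V -> V) : V -> V :=
  match l with
  | [::] => f
  | i :: l' => fun x => 'D_(e_ i) (iter_partial l' f) x
  end.

Definition smooth_on (U : set V) (f : V -> V) : Prop :=
  forall l : seq 'I_n,
    (forall x, U x -> {for x, continuous (iter_partial l f)}) /\
    (forall (i : 'I_n) x, U x -> derivable (iter_partial l f) x (e_ i)).

Definition diffeo_germ0 (U : set V) (F G : V -> V) : Prop :=
  open U /\ U 0 /\ F 0 = 0 /\ open (F @` U) /\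
  smooth_on U F /\ smooth_on (F @` U) G /\
  (forall x, U x -> G (F x) = x) /\
  (forall y, (F @` U) y -> F (G y) = y).

Definition maps_germ_into_line (U : set V) (F : V -> V) (K : set V) : Prop :=
  exists W : set V, open W /\ W 0 /\ W `<=` U /\
    exists L, is_line L /\ F @` (K `&` W) `<=` L.

Definition rectifiable (S : set (set V)) : Prop :=
  exists U F G, diffeo_germ0 U F G /\
    forall K, S K -> maps_germ_into_line U F K.

Definition complete_rectifiable_bundle (S : set (set V)) : Prop :=
  simple_bundle S /\ complete_bundle S /\ rectifiable S.

Definition normalized_rectifier (S : set (set V)) (U : set V) (Phi Psi : V -> V)
  : Prop :=
  diffeo_germ0 U Phi Psi /\
  (forall j : 'I_n, 'D_(e_ j) Phi 0 = e_ j) /\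
  forall K, S K -> maps_germ_into_line (Phi @` U) Psi K.

Definition quad_coeffs := 'I_n -> 'I_n -> 'I_n -> R.

Definition qmap (Q : quad_coeffs) (z : 'rV[R[i]]_n) : 'rV[R[i]]_n :=
  \row_k \sum_(i < n) \sum_(j < n) ((Q k i j)%:C)%C * z 0 i * z 0 j.

Definition in_Vn (Q : quad_coeffs) : Prop :=
  forall z, asym_cone z -> dotC z (qmap Q z) = 0 /\
                            dotC (qmap Q z) (qmap Q z) = 0.

Definition eq_mod_Wn (Q1 Q2 : quad_coeffs) : Prop :=
  exists lam : 'I_n -> R, forall z : 'rV[R[i]]_n,
    qmap Q1 z - qmap Q2 z = (\sum_(i < n) ((lam i)%:C)%C * z 0 i) *: z.

(** The quadratic part Phi_2 of the Taylor expansion at 0: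
    Phi_2(x)_k = 1/2 sum_{i,j} d_i d_j Phi_k (0) x_i x_j. *)
Definition quad_part (Phi : V -> V) : quad_coeffs :=
  fun k i j => 2^-1 * (iter_partial [:: i; j] Phi 0) 0 k.

End Defs.

(* Main.v *)
Require Import Defs.
From HB Require Import structures.
From mathcomp Require Import all_boot all_order all_algebra.
From mathcomp Require Import all_classical all_reals all_analysis.
From mathcomp Require Import complex.
From mathcomp Require Import ring lra.

(** Through every direction d a circle tangent to d at 0 is
    K(d, N) = {x | x = a d + (|x|^2 / |d|^2) N}, where only N modulo d matters.
    If Phi is a normalized rectifier, Phi(t d) stays on K(d, N) for small t;
    differentiating this relation two, three and four times at t = 0 gives N = Phi_2(d)
    modulo d (so the class of Phi_2 modulo W_n determines the bundle and
    conversely) and two polynomial identities in d which, extended to the cone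
    (x, x) = 0, say that Phi_2 lies in V_n.

    Conversely, for Gam in V_n subtract a map l(x) x so that (x, Gam(x)) = 0 for
    all x; then |Gam|^2 = |x|^2 q with q a nonnegative quadratic form, and
    Phi(x) = (x + Gam(x)) / (1 + q(x)) maps each line through 0 to a circle.
    Its inverse is rational, because Phi(v) = x forces a system of equations on v
    that is linear for fixed x. *)

Set Implicit Arguments. Unset Strict Implicit. Unset Printing Implicit Defensive.
Import Order.TTheory GRing.Theory Num.Theory.
Import numFieldNormedType.Exports.
Local Open Scope classical_set_scope.
Local Open Scope ring_scope.

(** * Partial derivatives and smoothness *)

(** The circle equation is used as [|d|^2 wedge x d = |x|^2 wedge N d]: it contains no parameter, so
    Leibniz' rule along [x = Phi (t d)] suffices. Its third and fourth derivatives involve unknown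
    jets of [Phi]. On the cone the terms with a factor [(z, z)] drop out and leave a scalar times
    [wedge (Phi_2 z) z]; either the scalar vanishes, or [Phi_2 z] is parallel to the isotropic
    vector [z] and the scalar vanishes all the same. At order four one unknown survives, the product
    of [z] with the third jet; it is removed by first dividing the third-order identity by [(d, d)].
    This division must work in every dimension, although [(x, x)] is reducible over the complex
    numbers for [n <= 2]. It is done by hand: if [v = x e0 + y] with [y] orthogonal to the unit
    vector [e0], then [(v, v)] is the monic polynomial [x^2 + |y|^2] in [x], and its root
    [x = i |y|] gives a point of the cone. Cramer's rule makes the inverse a quotient of
    polynomials, so its smoothness follows from closure under sums, products and inverses, without
    an inverse function theorem. *)

Section LineDerivative.
Context {R : realType} {V W : normedModType R}.
Implicit Types (g : V -> W) (x v y : V) (t : R).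

Lemma is_derive_line g v y t : derivable g (t *: v + y) v ->
  is_derive t (1 : R) (fun s : R => g (s *: v + y)) ('D_v g (t *: v + y)).
Proof.
move=> dg.
have E : (fun h => h^-1 *: (g (h *: v + (t *: v + y)) - g (t *: v + y))) =
    (fun h : R => h^-1 *: (g ((h *: (1:R) + t) *: v + y) - g (t *: v + y))).
  by apply/funext => h; rewrite scalerDl addrA [_%:A]mulr1.
by apply: DeriveDef; rewrite /derivable /derive /= -E.
Qed.

End LineDerivative.

Lemma diff_expansion {R : realType} (V W : normedModType R) (f : V -> W)
  (df : {linear V -> W}) (x : V) : continuous df ->
  (forall eps : R, 0 < eps -> \forall h \near (0 : V),
     `|f (h + x) - (f x + df h)| <= eps * `|h|) ->
  differentiable f x /\ 'd f x = df :> (V -> W).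
Proof.
move=> cdf H.
have E : f \o shift x = cst (f x) + df +o_ 0 id by apply/eqaddoP.
have D := diff_unique cdf E.
by split=> //; apply/diff_locallyP; rewrite D; split.
Qed.

Section PartialDerivatives.
Context {R : realType} {n : nat}.
Local Notation V := 'rV[R]_n.
Implicit Types (f g : V -> R) (U : set V) (x h : V).

Lemma coord_norm_le (h : V) k : `|h 0 k| <= `|h|.
Proof.
by rewrite [leRHS]/Num.Def.normr/= mx_normrE; exact: (le_bigmax _ _ (ord0, k)).
Qed.

(** The increment is split coordinate by coordinate, with the one-variable mean value theorem for
    each piece. The norm is the maximum of the coordinates, so the intermediate points [x + hk k]
    stay at distance less than [r] from [x]. *)
Lemma increment_le g x h (r eps : R) :
  (forall y, `|y - x| < r -> forall i, derivable g y (e_ R i) /\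
     `|'D_(e_ R i) g y| <= eps) ->
  `|h| < r -> `|g (x + h) - g x| <= n%:R * (eps * `|h|).
Proof.
move=> Hg hr.
have r0 : 0 < r by exact: le_lt_trans (normr_ge0 h) hr.
pose hk k : V := \row_i (if (i < k)%N then h 0 i else 0).
have hkn (w : V) : (forall i, `|w 0 i| <= `|h 0 i|) -> `|w| < r.
  move=> wh; apply: le_lt_trans hr.
  rewrite [leLHS]/Num.Def.normr/= mx_normrE (bigmax_le _ (normr_ge0 h))//=.
  by move=> [a b] _; rewrite ord1; apply: le_trans (wh b) (coord_norm_le _ _).
suff H k : (k <= n)%N -> `|g (x + hk k) - g x| <= k%:R * (eps * `|h|).
  have hkE : hk n = h by apply/rowP => i; rewrite mxE ltn_ord.
  by have := H n (leqnn n); rewrite hkE.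
elim: k => [_|k IH kn].
  rewrite (_ : hk 0%N = 0) ?addr0 ?subrr ?normr0 ?mul0r//.
  by apply/rowP => i; rewrite !mxE.
pose i0 := Ordinal kn.
pose y := x + hk k.
have hkS : x + hk k.+1 = h 0 i0 *: e_ R i0 + y.
  rewrite /y addrCA; congr (_ + _); apply/rowP => i; rewrite !mxE eqxx/=.
  have [->|ni] := eqVneq i i0; first by rewrite /= ltnS leqnn ltnn mulr1 addr0.
  rewrite mulr0 add0r ltnS leq_eqVlt; case: eqP => //= ik.
  by case/eqP: ni; apply: val_inj.
have ball_y (t : R) : `|t| <= `|h 0 i0| -> `|t *: e_ R i0 + y - x| < r.
  move=> th; rewrite /y addrCA addrAC subrr add0r; apply: hkn => i.
  rewrite !mxE eqxx/=; have [->|ni] := eqVneq i i0.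
    by rewrite ltnn mulr1 addr0.
  by rewrite mulr0 add0r; case: ifP => // _; rewrite normr0.
pose phi (t : R) := g (t *: e_ R i0 + y).
have dphi (t : R) : `|t| <= `|h 0 i0| ->
   is_derive t (1 : R) phi ('D_(e_ R i0) g (t *: e_ R i0 + y)).
  by move=> /ball_y /Hg /(_ i0) [dg _]; apply: is_derive_line.
have bphi : `|phi (h 0 i0) - phi 0| <= eps * `|h 0 i0|.
  have cphi (a b : R) : (forall t, t \in `[a, b] -> `|t| <= `|h 0 i0|) ->
     {within `[a, b], continuous phi}.
    move=> ab; apply: derivable_within_continuous => t /ab /dphi [] //.
  have bd (t : R) : `|t| <= `|h 0 i0| ->
     `|'D_(e_ R i0) g (t *: e_ R i0 + y)| <= eps.
    by move=> /ball_y /Hg /(_ i0) [].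
  have [h0|h0] := leP 0 (h 0 i0).
    have H t : t \in `[0, h 0 i0] -> `|t| <= `|h 0 i0|.
      by rewrite in_itv/= => /andP[t0 th]; rewrite !ger0_norm.
    have [c /H ch ->] := MVT_segment h0
      (fun t tin => dphi t (H t (subset_itv_oo_cc tin))) (cphi _ _ H).
    by rewrite subr0 normrM ler_wpM2r// bd.
  have H t : t \in `[h 0 i0, 0] -> `|t| <= `|h 0 i0|.
    rewrite in_itv/= => /andP[th t0].
    by rewrite !ler0_norm ?lerN2// ltW.
  have [c /H ch] := MVT_segment (ltW h0)
    (fun t tin => dphi t (H t (subset_itv_oo_cc tin))) (cphi _ _ H).
  rewrite distrC => ->.
  by rewrite sub0r normrM normrN ler_wpM2r// bd.
rewrite hkS -(subrKA (g y)) (le_trans (ler_normD _ _))//.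
rewrite mulrSr mulrDl mul1r addrC lerD ?(IH (ltnW kn))//.
have -> : g y = phi 0 by rewrite /phi scale0r add0r.
have eps0 : 0 <= eps.
  have /Hg /(_ i0) [_] : `|x - x| < r by rewrite subrr normr0.
  exact: le_trans.
by apply: le_trans bphi _; rewrite ler_wpM2l ?coord_norm_le.
Qed.

Definition gradient f x (h : V) : R := \sum_i h 0 i * 'D_(e_ R i) f x.

Fact gradient_is_linear f x : linear (gradient f x).
Proof.
move=> a u w; rewrite /gradient scaler_sumr -big_split/=; apply: eq_bigr => i _.
by rewrite !mxE /GRing.scale/= mulrDl mulrA.
Qed.

HB.instance Definition _ f x :=
  GRing.isLinear.Build R V R *:%R (gradient f x) (gradient_is_linear f x).

Lemma gradient_coord f x i : gradient f x (e_ R i) = 'D_(e_ R i) f x.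
Proof.
rewrite /gradient (bigD1 i)//= big1 ?addr0 => [|j ji]; rewrite mxE eqxx/=.
  by rewrite eqxx mul1r.
by rewrite (negbTE ji) mul0r.
Qed.

Lemma gradient_continuous f x : continuous (gradient f x).
Proof.
apply: continuous_big => [|i _]; first by move=> z; apply: cvgD; [exact: cvg_fst|exact: cvg_snd].
move=> y; exact (cvgMr_tmp (@coord_continuous R 1 n 0 i y)).
Qed.

Lemma gradient_derivable f x y v : derivable (gradient f x) y v.
Proof.
apply: diff_derivable; apply: linear_differentiable.
exact: gradient_continuous.
Qed.

Lemma derive_gradient f x y v : 'D_v (gradient f x) y = gradient f x v.
Proof.
rewrite deriveE; last exact/linear_differentiable/gradient_continuous.
by rewrite diff_lin//; exact: gradient_continuous.
Qed.

Section C1.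
Variables (f : V -> R) (x : V).
Hypothesis df : \forall y \near x, forall i, derivable f y (e_ R i).
Hypothesis cf : forall i, {for x, continuous ('D_(e_ R i) f)}.

(** [increment_le] is applied to [f - gradient f x], whose partial derivatives at [y] are the
    differences of those of [f] at [y] and at [x], small by continuity. *)
Let C1_diff : differentiable f x /\ 'd f x = gradient f x :> (V -> R).
Proof.
apply: diff_expansion; first exact: gradient_continuous.
move=> eps eps0.
(* [increment_le] costs a factor [n]; the denominator [n.+1] absorbs it and is nonzero even for
   [n = 0]. *)
pose e := eps / (n.+1)%:R.
have e0 : 0 < e by rewrite divr_gt0// ltr0n.
have B : \forall y \near x, forall i, `|'D_(e_ R i) f x - 'D_(e_ R i) f y| <= e.
  have H i : \forall y \near x, `|'D_(e_ R i) f x - 'D_(e_ R i) f y| <= e.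
    by have /cvgrPdist_le := @cf i; apply.
  exact (filter_forall _ H).
have [r /= r0 Hr] := (nbhs_ballP _ _).1 (filterI df B).
near=> h => /=.
have hr : `|h| < r.
  by near: h; apply/nbhs_ballP; exists r => //= z; rewrite -ball_normE/= sub0r normrN.
pose g (y : V) : R := f y - gradient f x y.
have -> : f (h + x) - (f x + gradient f x h) = g (x + h) - g x.
  have gD : gradient f x (x + h) = gradient f x x + gradient f x h by exact: linearD.
  rewrite /g gD [h + x]addrC; ring.
have Hg (y : V) : `|y - x| < r -> forall i, derivable g y (e_ R i) /\
    `|'D_(e_ R i) g y| <= e.
  move=> yr i.
  have [dfy Dfy] : (forall i, derivable f y (e_ R i)) /\
    (forall i, `|'D_(e_ R i) f x - 'D_(e_ R i) f y| <= e).
    by apply: Hr; rewrite -ball_normE/= distrC.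
  have dg := @gradient_derivable f x y (e_ R i).
  split; first exact: (@derivableB _ _ _ f (gradient f x) y _ (dfy i) dg).
  rewrite (_ : g = f - gradient f x)// (@deriveB _ _ _ f (gradient f x) y _ (dfy i) dg).
  by rewrite derive_gradient gradient_coord distrC.
apply: le_trans (increment_le Hg hr) _.
rewrite mulrA ler_wpM2r// /e mulrCA ler_piMr ?(ltW eps0)//.
by rewrite ler_pdivrMr ?ltr0n// mul1r ler_nat.
Unshelve. all: by end_near. Qed.

Lemma C1_differentiable : differentiable f x. Proof. exact: C1_diff.1. Qed.

Lemma C1_derive v : 'D_v f x = \sum_i v 0 i * 'D_(e_ R i) f x.
Proof. by rewrite deriveE ?C1_diff.2//; exact: C1_differentiable. Qed.

End C1.

End PartialDerivatives.

(** * Closure properties of smooth scalar functions *)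

Section Smooth.
Context {R : realType} {n : nat}.
Local Notation V := 'rV[R]_n.
Implicit Types (f g : V -> R) (U : set V) (k : nat).

(** Scalar counterpart of [smooth_on], graded by the number of derivatives: the derivative of a
    product or of an inverse contains the functions themselves, so closure is proved by induction on
    [k], dropping one level at a time. *)
Fixpoint Ck k U f : Prop :=
  (forall x, U x -> {for x, continuous f}) /\
  if k is k'.+1 then
    forall i, (forall x, U x -> derivable f x (e_ R i)) /\ Ck k' U ('D_(e_ R i) f)
  else True.

Definition smoothR U f := forall k, Ck k U f.

Lemma Ck_continuous k U f : Ck k U f -> forall x, U x -> {for x, continuous f}.
Proof. by case: k => [|k] []. Qed.

Lemma Ck_S k U f : Ck k.+1 U f -> Ck k U f.
Proof.
elim: k f => [|k IH] f [cf H]; first by split.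
by split=> // i; have [df Df] := H i; split=> //; exact: IH.
Qed.

Lemma smoothR_derive U f i : smoothR U f -> smoothR U ('D_(e_ R i) f).
Proof. by move=> sf k; have [_ /(_ i)[]] := sf k.+1. Qed.

Lemma smoothR_derivable U f x i : smoothR U f -> U x -> derivable f x (e_ R i).
Proof. by move=> sf; have [_ /(_ i)[+ _]] := sf 1%N; exact. Qed.

Lemma smoothR_continuous U f x : smoothR U f -> U x -> {for x, continuous f}.
Proof. by move=> /(_ 0%N) [cf _]; exact: cf. Qed.

Lemma near_open U x : open U -> U x -> \forall y \near x, U y.
Proof. by move=> oU Ux; exact: open_nbhs_nbhs. Qed.

Lemma Ck1_differentiable U f x : open U -> Ck 1 U f -> U x -> differentiable f x.
Proof.
move=> oU [_ H] Ux; apply: C1_differentiable.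
  by near=> y => i; apply (H i).1; near: y; exact: near_open.
by move=> i; exact ((H i).2.1 x Ux).
Unshelve. all: by end_near. Qed.

Lemma Ck1_derive U f x (v : V) : open U -> Ck 1 U f -> U x ->
  'D_v f x = \sum_i v 0 i * 'D_(e_ R i) f x.
Proof.
move=> oU [_ H] Ux; apply: C1_derive.
  by near=> y => i; apply (H i).1; near: y; exact: near_open.
by move=> i; exact ((H i).2.1 x Ux).
Unshelve. all: by end_near. Qed.

Lemma smoothR_differentiable U f x : open U -> smoothR U f -> U x ->
  differentiable f x.
Proof. by move=> oU sf; exact: Ck1_differentiable. Qed.

Lemma smoothR_deriveE U f x (v : V) : open U -> smoothR U f -> U x ->
  'D_v f x = \sum_i v 0 i * 'D_(e_ R i) f x.
Proof. by move=> oU sf; exact: Ck1_derive. Qed.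

Lemma Ck_sub k U U' f : U' `<=` U -> Ck k U f -> Ck k U' f.
Proof.
move=> UU'; elim: k f => [|k IH] f [cf H]; split=> //.
- by move=> x /UU' /cf.
- by move=> x /UU' /cf.
- move=> i; have [df Df] := H i; split; last exact: IH.
  by move=> x /UU' /df.
Qed.

Lemma near_eq_continuous (T : topologicalType) (f g : T -> R) x :
  (\forall y \near x, f y = g y) -> {for x, continuous f} -> {for x, continuous g}.
Proof.
move=> fg cf; rewrite /prop_for /continuous_at -(nbhs_singleton fg).
by apply: cvg_trans cf; exact: near_eq_cvg.
Qed.

Lemma Ck_ext k U f g : open U -> (forall x, U x -> f x = g x) ->
  Ck k U f -> Ck k U g.
Proof.
move=> oU; have fgn f' g' x : (forall x, U x -> f' x = g' x :> R) -> U x ->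
    \forall y \near x, f' y = g' y.
  by move=> fg Ux; near=> y; apply: fg; near: y; exact: near_open.
elim: k f g => [|k IH] f g fg [cf H].
  by split=> // x Ux; exact (near_eq_continuous (fgn _ _ _ fg Ux) (cf x Ux)).
split=> [x Ux|i]; first exact (near_eq_continuous (fgn _ _ _ fg Ux) (cf x Ux)).
have [df Df] := H i; split=> [x Ux|].
  exact: near_eq_derivable (fgn _ _ _ fg Ux) (df x Ux).
by apply: IH Df => x Ux; exact: near_eq_derive (fgn _ _ _ fg Ux).
Unshelve. all: by end_near. Qed.

Lemma Ck_cst k U (a : R) : Ck k U (cst a).
Proof.
elim: k a => [|k IH] a; first by split=> // x _; exact: cst_continuous.
split=> [x _|i]; first exact: cst_continuous.
split=> [x _|]; first exact: derivable_cst.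
rewrite (_ : 'D_(e_ R i) (cst a) = cst 0); first exact: IH.
by apply/funext => x; exact: derive_cst.
Qed.

Lemma Ck_coord k U j : Ck k U (fun x : V => x 0 j).
Proof.
have c : continuous (fun x : V => x 0 j : R) by exact: (@coord_continuous R 1 n 0 j).
case: k => [|k]; first by split=> // x _; exact: c.
split=> [x _|i]; first exact: c.
have d x v : is_derive x v (fun x : V => x 0 j : R) (v 0 j).
  have E : (fun h : R => h^-1 *: ((h *: v + x) 0 j - x 0 j)) @ 0^' --> v 0 j.
    apply: (@cvg_trans _ ((fun=> v 0 j) @ 0^')); last exact: cvg_cst.
    apply: near_eq_cvg; near=> h.
    rewrite !mxE addrK /GRing.scale/= mulKf//.
    by near: h; exact: nbhs_dnbhs_neq.
  by apply: DeriveDef; [apply/cvg_ex; exists (v 0 j) | exact: cvg_lim E].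
split=> [x _|]; first by have [] := d x (e_ R i).
rewrite (_ : 'D_(e_ R i) _ = cst (e_ R i 0 j)); first exact: Ck_cst.
by apply/funext => x; have [] := d x (e_ R i).
Unshelve. all: by end_near. Qed.

Lemma CkD k U f g : open U -> Ck k U f -> Ck k U g -> Ck k U (fun x => f x + g x).
Proof.
move=> oU; elim: k f g => [|k IH] f g [cf Hf] [cg Hg].
  by split=> // x Ux; exact (continuousD (cf x Ux) (cg x Ux)).
split=> [x Ux|i]; first exact (continuousD (cf x Ux) (cg x Ux)).
have [df Df] := Hf i; have [dg Dg] := Hg i; split=> [x Ux|].
  exact (@derivableD _ _ _ f g x _ (df x Ux) (dg x Ux)).
apply: Ck_ext (IH _ _ Df Dg) => // x Ux.
by rewrite -(@deriveD _ _ _ f g x _ (df x Ux) (dg x Ux)).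
Qed.

Lemma CkM k U f g : open U -> Ck k U f -> Ck k U g -> Ck k U (fun x => f x * g x).
Proof.
move=> oU; elim: k f g => [|k IH] f g Hf Hg.
  by split=> // x Ux; exact (continuousM (Hf.1 x Ux) (Hg.1 x Ux)).
split=> [x Ux|i]; first exact (continuousM (Hf.1 x Ux) (Hg.1 x Ux)).
have [df Df] := Hf.2 i; have [dg Dg] := Hg.2 i; split=> [x Ux|].
  exact (@derivableM _ _ f g x _ (df x Ux) (dg x Ux)).
apply: Ck_ext (CkD oU (IH _ _ (Ck_S Hf) Dg) (IH _ _ (Ck_S Hg) Df)) => // x Ux.
by rewrite -(@deriveM _ _ f g x _ (df x Ux) (dg x Ux)).
Qed.

Lemma CkV k U f : open U -> (forall x, U x -> f x != 0) ->
  Ck k U f -> Ck k U (fun x => (f x)^-1).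
Proof.
move=> oU fn0; elim: k => [|k IH] Hf.
  by split=> // x Ux; exact (continuousV (fn0 x Ux) (Hf.1 x Ux)).
split=> [x Ux|i]; first exact (continuousV (fn0 x Ux) (Hf.1 x Ux)).
have [df Df] := Hf.2 i; split=> [x Ux|].
  exact (@derivableV _ _ f x _ (fn0 x Ux) (df x Ux)).
have H := IH (Ck_S Hf).
apply: Ck_ext (CkM oU (CkM oU (Ck_cst k U (-1)) (CkM oU H H)) Df) => // x Ux.
rewrite (@deriveV _ _ f x _ (fn0 x Ux) (df x Ux)) /GRing.scale/=.
by rewrite /cst mulN1r expr2 invfM.
Qed.

Lemma Ck_sum k U (I : finType) (F : I -> V -> R) : open U ->
  (forall i, Ck k U (F i)) -> Ck k U (fun x => \sum_i F i x).
Proof.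
move=> oU H; elim: (index_enum I) => [|i s IH].
  by apply: Ck_ext (Ck_cst k U 0) => // x _; rewrite big_nil.
by apply: Ck_ext (CkD oU (H i) IH) => // x _; rewrite big_cons.
Qed.

Lemma Ck_prod k U (I : finType) (F : I -> V -> R) : open U ->
  (forall i, Ck k U (F i)) -> Ck k U (fun x => \prod_i F i x).
Proof.
move=> oU H; elim: (index_enum I) => [|i s IH].
  by apply: Ck_ext (Ck_cst k U 1) => // x _; rewrite big_nil.
by apply: Ck_ext (CkM oU (H i) IH) => // x _; rewrite big_cons.
Qed.

Lemma row_continuous {T : topologicalType} (F : T -> V) (x : T) :
  (forall j, {for x, continuous (fun y => F y 0 j : R)}) -> {for x, continuous F}.
Proof.
move=> H; apply/(@cvgrPdist_le R V) => /= e e0.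
have K j : \forall y \near x, `|F x 0 j - F y 0 j| <= e.
  by have /cvgrPdist_le := @H j; apply.
have K' : \forall y \near x, forall j, `|F x 0 j - F y 0 j| <= e.
  exact (filter_forall _ K).
near=> y; have Hy : forall j, `|F x 0 j - F y 0 j| <= e by near: y; exact K'.
rewrite [leLHS]/Num.Def.normr/= mx_normrE (bigmax_le _ (ltW e0))//=.
by move=> [a j] _ /=; rewrite ord1 !mxE; exact: Hy.
Unshelve. all: by end_near. Qed.

Lemma row_coord_continuous {T : topologicalType} (F : T -> V) (x : T) j :
  {for x, continuous F} -> {for x, continuous (fun y => F y 0 j : R)}.
Proof. by move=> c; exact (continuous_comp c (@coord_continuous R 1 n 0 j (F x))). Qed.

Lemma mulmxr_continuous (A : 'M[R]_n) : continuous (fun x : V => x *m A).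
Proof.
move=> x; apply: row_continuous => j.
rewrite (_ : (fun y => _) = (fun y : V => \sum_i y 0 i * A i j)); last first.
  by apply/funext => y; rewrite mxE.
have C : Ck 0 setT (fun y : V => \sum_i y 0 i * A i j).
  apply: Ck_sum => [|i]; first exact: openT.
  by apply: CkM; [exact: openT|exact: Ck_coord|exact: Ck_cst].
exact (Ck_continuous C I).
Qed.

(** The chain rule produces the oblique direction [e_ R i *m A]; differentiability expresses that
    derivative through partial derivatives, to which the induction applies. *)
Lemma Ck_linear k U (A : 'M[R]_n) f : open U -> Ck k U f ->
  Ck k [set x | U (x *m A)] (fun x => f (x *m A)).
Proof.
move=> oU; have cA := @mulmxr_continuous A.
have oU' : open [set x : V | U (x *m A)].
  by have /continuousP := cA; apply.
elim: k f => [|k IH] f Hf.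
  split=> // x Ux; exact (continuous_comp (@cA x) (Hf.1 (x *m A) Ux)).
split=> [x Ux|i]; first exact (continuous_comp (@cA x) (Hf.1 (x *m A) Ux)).
have E x v : derivable (fun x : V => f (x *m A)) x v =
    derivable f (x *m A) (v *m A) /\
   'D_v (fun x : V => f (x *m A)) x = 'D_(v *m A) f (x *m A).
  rewrite /derivable /derive (_ : (fun h : R => h^-1 *:
    (((fun x : V => f (x *m A)) \o shift x) (h *: v) - f (x *m A))) =
    (fun h : R => h^-1 *: ((f \o shift (x *m A)) (h *: (v *m A)) - f (x *m A))))//.
  by apply/funext => h /=; rewrite mulmxDl scalemxAl.
have H1 : Ck 1 U f.
  by case: k Hf {IH} => // k [cf H]; split=> // j; have [df [c _]] := H j.
have df x : U (x *m A) -> differentiable f (x *m A).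
  by move=> Ux; exact: Ck1_differentiable H1 Ux.
split=> [x Ux|].
  by rewrite (E x (e_ R i)).1; apply: diff_derivable; exact: df.
apply: (@Ck_ext _ _ (fun x => \sum_j (e_ R i *m A) 0 j * 'D_(e_ R j) f (x *m A))) => //.
  by move=> x Ux; rewrite (E x (e_ R i)).2 (Ck1_derive _ oU H1 Ux).
apply: Ck_sum => // j; apply: CkM => //; first exact: Ck_cst.
exact (IH _ (Hf.2 j).2).
Qed.

End Smooth.

Section SmoothVector.
Context {R : realType} {n : nat}.
Local Notation V := 'rV[R]_n.
Implicit Types (F : V -> V) (f g : V -> R) (U : set V) (x v : V).

Lemma row_derivable F x v : derivable F x v <->
  forall j, derivable (fun y => F y 0 j : R) x v.
Proof.
split=> [/derivable_mxP H j|H]; first exact: H.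
by apply/derivable_mxP => i j; rewrite ord1; exact: H.
Qed.

Lemma row_derive F x v j : derivable F x v ->
  ('D_v F x) 0 j = 'D_v (fun y => F y 0 j : R) x.
Proof. by move=> /derive_mx ->; rewrite mxE. Qed.

Lemma smooth_on_coord U F j : open U -> smooth_on U F ->
  smoothR U (fun x => F x 0 j).
Proof.
(* The empty list is made visible so that the induction can range over all lists: one level of [Ck]
   prepends one index. *)
move=> oU sF k; change (Ck k U (fun x => iter_partial [::] F x 0 j)).
elim: k [::] => [|k IH] l; have [cl dl] := sF l.
  by split=> // x Ux; exact (@row_coord_continuous R n _ _ x j (cl x Ux)).
split=> [x Ux|i]; first exact (@row_coord_continuous R n _ _ x j (cl x Ux)).
split=> [x Ux|]; first by have /row_derivable := dl i x Ux; apply.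
apply: Ck_ext (IH (i :: l)) => // x Ux.
by rewrite /= (row_derive _ (dl i x Ux)).
Qed.

Lemma coord_smooth_on U F : open U ->
  (forall j, smoothR U (fun x => F x 0 j)) -> smooth_on U F.
Proof.
move=> oU sF l.
suff H j : smoothR U (fun x => iter_partial l F x 0 j).
  split=> [x Ux|i x Ux].
    by apply: row_continuous => j; exact (smoothR_continuous (H j) Ux).
  by apply/row_derivable => j; exact (@smoothR_derivable _ _ U _ x i (H j) Ux).
elim: l j => [|i l IH] j; first exact: sF.
move=> k; apply: Ck_ext (@smoothR_derive _ _ U _ i (IH j) k) => // x Ux /=.
rewrite row_derive//; apply/row_derivable => j'.
exact (@smoothR_derivable _ _ U _ x i (IH j') Ux).
Qed.

Lemma quad_partE U F k i j : open U -> smooth_on U F -> U 0 ->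
  quad_part F k i j = 2^-1 * 'D_(e_ R i) ('D_(e_ R j) (fun x => F x 0 k)) 0.
Proof.
move=> oU sF U0; rewrite /quad_part; congr (_ * _).
rewrite [iter_partial _ _]/= row_derive; last exact: ((sF [:: j]).2 i 0 U0).
apply: near_eq_derive; near=> x.
have Ux : U x by near: x; exact: near_open.
by rewrite row_derive//; exact: ((sF [::]).2 j x Ux).
Unshelve. all: by end_near. Qed.

Lemma smoothR_derive_dir U f v : open U -> smoothR U f -> smoothR U ('D_v f).
Proof.
move=> oU sf k; apply: (@Ck_ext _ _ _ _ (fun x => \sum_i v 0 i * 'D_(e_ R i) f x)) => //.
  by move=> x Ux; rewrite (smoothR_deriveE v oU sf Ux).
apply: Ck_sum => // i; apply: CkM => //; first exact: Ck_cst.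
exact: smoothR_derive.
Qed.

(** For smooth [f], its value at [t v] is the [m]-th derivative of [t |-> f (t v)], and at a fixed
    point it is polynomial in [v]; both views are used. *)
Definition dern m v f : V -> R := iter m (fun g => 'D_v g) f.

Lemma smoothR_dern U f v m : open U -> smoothR U f -> smoothR U (dern m v f).
Proof. by move=> oU sf; elim: m => //= m IH; exact: smoothR_derive_dir. Qed.

Lemma dern_ext U f g v m x : open U -> (forall x, U x -> f x = g x) -> U x ->
  dern m v f x = dern m v g x.
Proof.
move=> oU fg; elim: m x => [|m IH] x Ux /=; first exact: fg.
apply: near_eq_derive; near=> y; apply: IH; near: y; exact: near_open.
Unshelve. all: by end_near. Qed.

Lemma dern_sum U (I : finType) (a : I -> R) (F : I -> V -> R) v m x : open U ->
  (forall i, smoothR U (F i)) -> U x ->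
  dern m v (fun x => \sum_i a i * F i x) x = \sum_i a i * dern m v (F i) x.
Proof.
move=> oU sF; elim: m x => [|m IH] x Ux //=.
pose G i := dern m v (F i).
have sG i : smoothR U (G i) by exact: smoothR_dern.
transitivity ('D_v (fun x => \sum_i a i * G i x) x).
  by apply: near_eq_derive; near=> y; apply: IH; near: y; exact: near_open.
have dG i : derivable (G i) x v.
  by apply: diff_derivable; exact: smoothR_differentiable (sG i) Ux.
suff [] : is_derive x v (fun x => \sum_i a i * G i x)
    (\sum_i a i * 'D_v (G i) x) by [].
elim: (index_enum I) => [|i s IHs].
  rewrite big_nil (_ : (fun y => _) = cst 0); first exact: is_derive_cst.
  by apply/funext => y; rewrite big_nil.
rewrite big_cons (_ : (fun y => _) =
    a i \*: G i + (fun y => \sum_(i <- s) a i * G i y)).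
  by apply: is_deriveD; apply: is_deriveZ; exact: derivableP.
by apply/funext => y; rewrite big_cons.
Unshelve. all: by end_near. Qed.

Lemma is_derive_ray U f v t : open U -> smoothR U f -> U (t *: v) ->
  is_derive t (1 : R) (fun s : R => f (s *: v)) ('D_v f (t *: v)).
Proof.
move=> oU sf Ut; have := @is_derive_line R V R f v 0 t.
rewrite addr0 => H.
have -> : (fun s : R => f (s *: v)) = (fun s => f (s *: v + 0)).
  by apply/funext => s; rewrite addr0.
by apply: H; apply: diff_derivable; exact: smoothR_differentiable sf Ut.
Qed.

End SmoothVector.

(** * Quadratic maps and the asymptotic cone *)

Section Complexification.
Context {R : realType} {n : nat}.
Local Notation C := R[i].
Local Notation V := 'rV[R]_n.
Local Notation VC := 'rV[C]_n.
Local Notation rc := (real_complex R).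
Implicit Types (f : V -> R) (g : VC -> C) (u v w : V) (Q : quad_coeffs R n).

Definition cplx u w : VC := \row_k (u 0 k +i* w 0 k)%C.

Lemma cplxE (z : VC) : exists u w, z = cplx u w.
Proof.
exists (\row_k complex.Re (z 0 k)), (\row_k complex.Im (z 0 k)).
by apply/rowP => k; rewrite !mxE; case: (z 0 k).
Qed.

Lemma poly_eq0 (p : {poly R}) : (forall s, p.[s] = 0) -> p = 0.
Proof.
move=> p0; apply/eqP/negPn/negP => pn0.
have := max_poly_roots (rs := [seq k%:R | k <- iota 0 (size p)]) pn0.
rewrite size_map size_iota ltnn => H; suff : false by [].
apply: H; first by apply/allP => x _; rewrite /root p0.
by rewrite map_inj_uniq ?iota_uniq//; move=> a b /eqP; rewrite eqr_nat => /eqP.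
Qed.

(* [g] is the complex extension of the real polynomial function [f]. *)
Definition complexified f g := forall u w, exists p : {poly R},
  (forall s, f (u + s *: w) = p.[s]) /\ g (cplx u w) = (map_poly rc p).['i%C].

(** The value at [u + i w] comes from the polynomial that [f] induces on the real line
    [s |-> u + s w], and that polynomial has infinitely many roots. *)
Lemma complexified_eq0 f g : complexified f g -> (forall v, f v = 0) ->
  forall z, g z = 0.
Proof.
move=> fg f0 z; have [u [w ->]] := cplxE z; have [p [fp ->]] := fg u w.
by rewrite (poly_eq0 (p := p)) ?rmorph0 ?horner0// => s; rewrite -fp.
Qed.

Lemma complexified_cst a : complexified (fun=> a) (fun=> rc a).
Proof.
by move=> u w; exists a%:P; split=> [s|]; rewrite ?map_polyC hornerC.
Qed.

Lemma complexified_coord k : complexified (fun v => v 0 k) (fun z => z 0 k).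
Proof.
move=> u w; exists ((u 0 k)%:P + w 0 k *: 'X); split=> [s|].
  by rewrite !hornerE !mxE mulrC.
rewrite rmorphD/= map_polyC map_polyZ/= map_polyX !hornerE mxE.
by apply/eqP; rewrite eq_complex/=; apply/andP; split; apply/eqP; ring.
Qed.

Lemma complexifiedD f g f' g' : complexified f g -> complexified f' g' ->
  complexified (fun v => f v + f' v) (fun z => g z + g' z).
Proof.
move=> H H' u w; have [p [fp gp]] := H u w; have [p' [fp' gp']] := H' u w.
exists (p + p'); split=> [s|]; first by rewrite fp fp' hornerD.
by rewrite gp gp' rmorphD hornerD.
Qed.

Lemma complexifiedM f g f' g' : complexified f g -> complexified f' g' ->
  complexified (fun v => f v * f' v) (fun z => g z * g' z).
Proof.
move=> H H' u w; have [p [fp gp]] := H u w; have [p' [fp' gp']] := H' u w.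
exists (p * p'); split=> [s|]; first by rewrite fp fp' hornerM.
by rewrite gp gp' rmorphM hornerM.
Qed.

Lemma complexifiedN f g : complexified f g ->
  complexified (fun v => - f v) (fun z => - g z).
Proof.
move=> H u w; have [p [fp gp]] := H u w; exists (- p).
by split=> [s|]; rewrite ?fp ?gp ?rmorphN hornerN.
Qed.

Lemma complexifiedB f g f' g' : complexified f g -> complexified f' g' ->
  complexified (fun v => f v - f' v) (fun z => g z - g' z).
Proof. by move=> H H'; apply: complexifiedD => //; exact: complexifiedN. Qed.

Lemma complexified_sum (I : finType) (F : I -> V -> R) (G : I -> VC -> C) :
  (forall i, complexified (F i) (G i)) ->
  complexified (fun v => \sum_i F i v) (fun z => \sum_i G i z).
Proof.
move=> H u w; pose P i := sval (cid (H i u w)).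
have PH i : (forall s, F i (u + s *: w) = (P i).[s]) /\
    G i (cplx u w) = (map_poly rc (P i)).['i%C] by exact: svalP (cid (H i u w)).
exists (\sum_i P i); split=> [s|].
  by rewrite horner_sum; apply: eq_bigr => i _; exact: (PH i).1.
by rewrite rmorph_sum horner_sum; apply: eq_bigr => i _; exact: (PH i).2.
Qed.

Definition qmapR Q v : V :=
  \row_k \sum_(i < n) \sum_(j < n) Q k i j * v 0 i * v 0 j.

(** Polarisation without the factor 1/2: it is the cross term of [qmapR Q (u + w)]. The bracket is
    symmetrised because the coefficients of [Q] need not be symmetric. *)
Definition qpolar Q u w : V :=
  \row_k \sum_(i < n) \sum_(j < n) Q k i j * (u 0 i * w 0 j + w 0 i * u 0 j).

Lemma complexified_qmap Q k :
  complexified (fun v => qmapR Q v 0 k) (fun z => qmap Q z 0 k).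
Proof.
rewrite (_ : (fun v => _) =
  (fun v => \sum_i \sum_j Q k i j * v 0 i * v 0 j)); last first.
  by apply/funext => v; rewrite mxE.
rewrite (_ : (fun z => _) =
  (fun z : VC => \sum_i \sum_j rc (Q k i j) * z 0 i * z 0 j)); last first.
  by apply/funext => v; rewrite mxE.
apply: complexified_sum => i; apply: complexified_sum => j.
apply: complexifiedM (complexified_coord j).
exact: complexifiedM (complexified_cst _) (complexified_coord i).
Qed.

Lemma complexified_dot (F F' : V -> V) (G G' : VC -> VC) :
  (forall k, complexified (fun v => F v 0 k) (fun z => G z 0 k)) ->
  (forall k, complexified (fun v => F' v 0 k) (fun z => G' z 0 k)) ->
  complexified (fun v => dotR (F v) (F' v)) (fun z => dotC (G z) (G' z)).
Proof. by move=> H H'; apply: complexified_sum => i; exact: complexifiedM. Qed.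

Lemma sum_complex (I : finType) (f g : I -> R) :
  \sum_i (f i +i* g i)%C = ((\sum_i f i) +i* (\sum_i g i))%C.
Proof. by elim/big_rec3: _ => // i x y z _ ->. Qed.

Lemma dotC_cplx u w u' w' : dotC (cplx u w) (cplx u' w') =
  ((dotR u u' - dotR w w') +i* (dotR u w' + dotR w u'))%C.
Proof.
rewrite /dotC (eq_bigr (fun k => ((u 0 k * u' 0 k - w 0 k * w' 0 k) +i*
  (u 0 k * w' 0 k + w 0 k * u' 0 k))%C)); last by move=> k _; rewrite !mxE.
by rewrite sum_complex; congr (_ +i* _)%C; [exact: sumrB|exact: big_split].
Qed.

Lemma qmap_cplx Q u w :
  qmap Q (cplx u w) = cplx (qmapR Q u - qmapR Q w) (qpolar Q u w).
Proof.
apply/rowP => k; rewrite !mxE.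
rewrite (eq_bigr (fun i => ((\sum_j (Q k i j * u 0 i * u 0 j -
   Q k i j * w 0 i * w 0 j)) +i*
   (\sum_j Q k i j * (u 0 i * w 0 j + w 0 i * u 0 j)))%C)).
  rewrite sum_complex; congr (_ +i* _)%C; rewrite -sumrB; apply: eq_bigr => i _.
  exact: sumrB.
move=> i _; rewrite -sum_complex; apply: eq_bigr => j _; rewrite !mxE.
by apply/eqP; rewrite eq_complex/=; apply/andP; split; apply/eqP; ring.
Qed.

End Complexification.

Section DotProduct.
Context {R : realType} {n : nat}.
Local Notation V := 'rV[R]_n.
Implicit Types (u v w : V) (a : R).

Lemma dotRC u v : dotR u v = dotR v u.
Proof. by apply: eq_bigr => i _; rewrite mulrC. Qed.

Lemma dotRDl u v w : dotR (u + v) w = dotR u w + dotR v w.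
Proof. by rewrite /dotR -big_split; apply: eq_bigr => i _; rewrite mxE mulrDl. Qed.

Lemma dotRZl a u w : dotR (a *: u) w = a * dotR u w.
Proof. by rewrite /dotR mulr_sumr; apply: eq_bigr => i _; rewrite mxE mulrA. Qed.

Lemma dotRDr u v w : dotR w (u + v) = dotR w u + dotR w v.
Proof. by rewrite !(dotRC w) dotRDl. Qed.

Lemma dotRZr a u w : dotR w (a *: u) = a * dotR w u.
Proof. by rewrite !(dotRC w) dotRZl. Qed.

Lemma dotRNl u w : dotR (- u) w = - dotR u w.
Proof. by rewrite -scaleN1r dotRZl mulN1r. Qed.

Lemma dotRNr u w : dotR w (- u) = - dotR w u.
Proof. by rewrite -scaleN1r dotRZr mulN1r. Qed.

Lemma dot0R w : dotR 0 w = 0.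
Proof. by rewrite -(scale0r 0) dotRZl mul0r. Qed.

Lemma dotR0 w : dotR w 0 = 0.
Proof. by rewrite dotRC dot0R. Qed.

Definition dotE := (dotRDl, dotRDr, dotRZl, dotRZr, dotRNl, dotRNr).

Lemma dotR_ge0 v : 0 <= dotR v v.
Proof. by apply: sumr_ge0 => i _; rewrite -expr2 sqr_ge0. Qed.

Lemma dotR_eq0 v : (dotR v v == 0) = (v == 0).
Proof.
apply/eqP/eqP => [v0|->]; last exact: dot0R.
apply/rowP => i; rewrite mxE; apply/eqP; rewrite -sqrf_eq0 expr2; apply/eqP.
by apply: (psumr_eq0P _ v0) => // j _; rewrite -expr2 sqr_ge0.
Qed.

Lemma dotR_gt0 v : v != 0 -> 0 < dotR v v.
Proof. by move=> v0; rewrite lt_def dotR_eq0 v0 dotR_ge0. Qed.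

Lemma dotR_e i v : dotR (e_ R i) v = v 0 i.
Proof.
rewrite /dotR (bigD1 i)//= big1 => [|j ji]; rewrite !mxE ?eqxx ?mul1r ?addr0//.
by rewrite (negbTE ji) mul0r.
Qed.

Lemma row_sum_e v : v = \sum_i v 0 i *: e_ R i.
Proof. exact: row_sum_delta. Qed.

Lemma dotR_sumr (I : finType) (F : I -> V) w : dotR w (\sum_i F i) = \sum_i dotR w (F i).
Proof. by elim/big_rec2: _ => [|i x y _ <-]; rewrite ?dotR0// dotRDr. Qed.

End DotProduct.

Section QuadraticMaps.
Context {R : realType} {n : nat}.
Local Notation V := 'rV[R]_n.
Implicit Types (u v w : V) (Q : quad_coeffs R n) (a b : R).

Lemma qmapR_comb Q a b u w : qmapR Q (a *: u + b *: w) =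
  a ^+ 2 *: qmapR Q u + (a * b) *: qpolar Q u w + b ^+ 2 *: qmapR Q w.
Proof.
apply/rowP => k; rewrite !mxE !mulr_sumr -!big_split/=; apply: eq_bigr => i _.
rewrite !mulr_sumr -!big_split/=; apply: eq_bigr => j _.
by rewrite !mxE; ring.
Qed.

Lemma qmapRZ Q a u : qmapR Q (a *: u) = a ^+ 2 *: qmapR Q u.
Proof. by have := qmapR_comb Q a 0 u 0; rewrite expr0n mulr0 !scale0r !addr0. Qed.

Lemma qmapR0 Q : qmapR Q 0 = 0.
Proof. by have := qmapRZ Q 0 0; rewrite scaler0 expr0n scale0r. Qed.

Lemma qpolarC Q u w : qpolar Q u w = qpolar Q w u.
Proof.
by apply/rowP => k; rewrite !mxE; do 2!apply: eq_bigr => ? _; rewrite [X in _ * X]addrC.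
Qed.

Lemma qpolarDr Q u v w : qpolar Q u (v + w) = qpolar Q u v + qpolar Q u w.
Proof.
apply/rowP => k; rewrite !mxE -!big_split/=; apply: eq_bigr => i _.
by rewrite -!big_split/=; apply: eq_bigr => j _; rewrite !mxE; ring.
Qed.

Lemma qpolarZr Q u a w : qpolar Q u (a *: w) = a *: qpolar Q u w.
Proof.
apply/rowP => k; rewrite !mxE !mulr_sumr; apply: eq_bigr => i _.
by rewrite !mulr_sumr; apply: eq_bigr => j _; rewrite !mxE; ring.
Qed.

Lemma qpolarvv Q v : qpolar Q v v = 2 *: qmapR Q v.
Proof.
apply/rowP => k; rewrite !mxE !mulr_sumr; apply: eq_bigr => i _.
by rewrite !mulr_sumr; apply: eq_bigr => j _; ring.
Qed.

Lemma qpolar0r Q u : qpolar Q u 0 = 0.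
Proof. by have := qpolarZr Q u 0 u; rewrite !scale0r. Qed.

Lemma qpolar_sumr (I : finType) Q u (F : I -> V) :
  qpolar Q u (\sum_i F i) = \sum_i qpolar Q u (F i).
Proof.
by elim/big_rec2: _ => [|i x y _ <-]; rewrite ?qpolar0r// qpolarDr.
Qed.

Lemma qmapRE Q v : qmapR Q v =
  2^-1 *: \sum_i \sum_j (v 0 i * v 0 j) *: qpolar Q (e_ R i) (e_ R j).
Proof.
rewrite -[LHS](@scalerK _ _ 2) ?pnatr_eq0// -qpolarvv; congr (_ *: _).
rewrite {2}(row_sum_e v) qpolar_sumr; under eq_bigr do rewrite qpolarZr qpolarC.
rewrite {2}(row_sum_e v); apply: eq_bigr => i _; rewrite qpolar_sumr scaler_sumr.
by apply: eq_bigr => j _; rewrite qpolarZr scalerA.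
Qed.

Definition linform (l : 'I_n -> R) v := \sum_i l i * v 0 i.

(* Comparing the values at [e_i + e_j] and [e_i - e_j] gives
   [qpolar e_i e_j = l_j e_i + l_i e_j] with [l_i] the factor at [e_i]. *)
Lemma radial_quadratic Q :
  (forall v j k, qmapR Q v 0 j * v 0 k = qmapR Q v 0 k * v 0 j) ->
  exists l, forall v, qmapR Q v = linform l v *: v.
Proof.
move=> H; pose l i := qmapR Q (e_ R i) 0 i; exists l => v.
have radial u i : u 0 i != 0 -> qmapR Q u = (qmapR Q u 0 i / u 0 i) *: u.
  by move=> ui; apply/rowP => k; rewrite [RHS]mxE mulrAC -H mulfK.
have eii i : e_ R i 0 i = 1 by rewrite /e_ mxE !eqxx.
have eij i j : i != j -> e_ R i 0 j = 0.
  by move=> /negbTE ij; rewrite /e_ mxE [j == i]eq_sym ij andbF.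
have He i : qmapR Q (e_ R i) = l i *: e_ R i.
  by rewrite (radial _ i) ?eii ?oner_eq0// divr1.
have key (u w : V) i j a b : u 0 i = 1 -> u 0 j = 0 -> w 0 i = 0 -> w 0 j = 1 ->
    qmapR Q u = a *: u -> qmapR Q w = b *: w -> qpolar Q u w = b *: u + a *: w.
  move=> ui uj wi wj Hu Hw.
  have E s : qmapR Q (u + s *: w) = a *: u + s *: qpolar Q u w + (s ^+ 2 * b) *: w.
    have := qmapR_comb Q 1 s u w.
    by rewrite scale1r expr1n mul1r scale1r Hu Hw scalerA => ->.
  move: (qpolar Q u w) E => P E.
  have W s k : a * u 0 k + s * P 0 k + s ^+ 2 * b * w 0 k =
      (a + s * P 0 i) * (u 0 k + s * w 0 k).
    have := H (u + s *: w) k i; rewrite E !mxE ui wi !mulr1 !mulr0 !addr0.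
    by rewrite mulr1.
  have Pi : P 0 i = b.
    have := W 1 j; have := W (-1) j; rewrite uj wj => h1 h2; lra.
  apply/rowP => k; rewrite !mxE.
  have := W 1 k; have := W (-1) k; rewrite Pi => h1 h2; lra.
have Hp i j : qpolar Q (e_ R i) (e_ R j) = l j *: e_ R i + l i *: e_ R j.
  have [->|ij] := eqVneq i j; first by rewrite qpolarvv He scaler_nat mulr2n.
  by apply: (key _ _ i j) => //; apply: eij => //; rewrite eq_sym.
rewrite qmapRE; under eq_bigr do under eq_bigr do rewrite Hp.
suff -> : \sum_i \sum_j (v 0 i * v 0 j) *: (l j *: e_ R i + l i *: e_ R j) =
    2 *: (linform l v *: v) by rewrite scalerK// pnatr_eq0.
have -> : linform l v *: v = \sum_i \sum_j (v 0 i * v 0 j * l j) *: e_ R i.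
  rewrite {2}(row_sum_e v) scaler_sumr; apply: eq_bigr => i _.
  rewrite -scaler_suml scalerA mulr_suml; congr (_ *: _).
  by apply: eq_bigr => j _; ring.
rewrite scaler_nat mulr2n.
under eq_bigr do under eq_bigr do rewrite scalerDr !scalerA.
under eq_bigr do rewrite big_split.
rewrite big_split/=; congr (_ + _); rewrite exchange_big/=.
by apply: eq_bigr => i _; apply: eq_bigr => j _; rewrite [v 0 j * _]mulrC.
Qed.

End QuadraticMaps.

(** * Division by [(x, x)], and vanishing on the cone *)

Section Cone.
Context {R : realType} {n : nat}.
Local Notation C := R[i].
Local Notation V := 'rV[R]_n.
Local Notation VC := 'rV[C]_n.
Local Notation rc := (real_complex R).
Implicit Types (u v w : V) (Q : quad_coeffs R n) (a b : R).

Lemma complex_eq0 a b : (a +i* b)%C = 0 -> a = 0 /\ b = 0.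
Proof. by case. Qed.

Lemma linform_ex (f : V -> R) : (forall a u w, f (a *: u + w) = a * f u + f w) ->
  exists l, forall v, f v = linform l v.
Proof.
move=> fl; exists (fun i => f (e_ R i)) => v.
have f0 : f 0 = 0 by have := fl (-1) 0 0; rewrite scaler0 addr0 mulN1r addNr.
rewrite {1}(row_sum_e v) /linform.
elim/big_rec2: _ => // i x y _ <-; by rewrite fl mulrC.
Qed.

Lemma in_Vn_split Q : in_Vn Q -> (forall z, asym_cone z -> dotC z (qmap Q z) = 0) /\
  (forall z, asym_cone z -> dotC (qmap Q z) (qmap Q z) = 0).
Proof. by move=> H; split=> z /H []. Qed.

Lemma cone_cplx u w : dotR u u = dotR w w -> dotR u w = 0 -> asym_cone (cplx u w).
Proof.
by move=> uw uw0; rewrite /asym_cone/= dotC_cplx uw subrr (dotRC w) uw0 addr0.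
Qed.

Section Slice.
Variables (Q : quad_coeffs R n) (e0 y v : V) (x r : R).
Hypothesis e0e0 : dotR e0 e0 = 1.
Hypothesis e0y : dotR e0 y = 0.
Hypothesis r2 : r ^+ 2 = dotR y y.
Hypothesis vE : v = x *: e0 + y.

(** With [v = x e0 + y] one has [(v, v) = x^2 + r^2]. Putting the root [i r] in place of [x] gives
    this point, where the remainder of a division by [(v, v)] can be read off. *)
Lemma slice_cone : asym_cone (cplx y (r *: e0)).
Proof.
apply: cone_cplx; last by rewrite dotRZr dotRC e0y mulr0.
by rewrite dotRZl dotRZr e0e0 -r2 mulr1 expr2.
Qed.

Let r0 : r = 0 -> y = 0.
Proof.
by move=> r0; apply/eqP; rewrite -dotR_eq0 -r2 r0 expr0n.
Qed.

Let vv : dotR v v = x ^+ 2 + r ^+ 2.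
Proof. by rewrite vE !dotE e0e0 (dotRC y) e0y r2; ring. Qed.

Let GvE : qmapR Q v =
  x ^+ 2 *: qmapR Q e0 + x *: qpolar Q e0 y + qmapR Q y.
Proof. by have := qmapR_comb Q x 1 e0 y; rewrite vE !scale1r mulr1 expr1n scale1r. Qed.

Let pvE : qpolar Q e0 v = (2 * x) *: qmapR Q e0 + qpolar Q e0 y.
Proof.
by rewrite vE qpolarDr !qpolarZr qpolarvv scalerA [x * _]mulrC.
Qed.

Let qmap_slice : qmap Q (cplx y (r *: e0)) =
  cplx (qmapR Q y - r ^+ 2 *: qmapR Q e0) (r *: qpolar Q e0 y).
Proof. by rewrite qmap_cplx qmapRZ qpolarZr qpolarC. Qed.

(** The left side is divided by [x^2 + r^2] as a polynomial in [x]; [E1] and [E2], the real and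
    imaginary parts of the hypothesis at the slice point, say that the remainder is zero. The
    quotient is written without [y], so that its linearity in [v] is visible. *)
Lemma slice_cubic : (forall z, asym_cone z -> dotC z (qmap Q z) = 0) ->
  dotR v (qmapR Q v) = dotR v v *
   (dotR e0 (qpolar Q e0 v) + dotR v (qmapR Q e0) - 2 * x * dotR e0 (qmapR Q e0)).
Proof.
move=> /(_ _ slice_cone); rewrite qmap_slice dotC_cplx => /complex_eq0.
move=> -[h1 h2]; rewrite !dotE in h1 h2.
have E1 : dotR y (qmapR Q y) = r ^+ 2 * (dotR y (qmapR Q e0) + dotR e0 (qpolar Q e0 y)).
  by rewrite mulrDr; lra.
have E2 : dotR e0 (qmapR Q y) =
    r ^+ 2 * dotR e0 (qmapR Q e0) - dotR y (qpolar Q e0 y).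
  (* The imaginary part carries a factor [r]. For [r = 0] it says nothing, but then [y = 0] and both
     sides vanish. *)
  have [rz|rn0] := eqVneq r 0.
    by rewrite (r0 rz) rz qpolar0r qmapR0 !dotR0 expr0n mul0r subr0.
  by apply: (mulfI rn0); lra.
rewrite vv GvE pvE vE !dotE E1 E2; ring.
Qed.

(** The same division in degree four; the quotient, again free of [y], is a quadratic form in
    [v]. *)
Lemma slice_quartic : (forall z, asym_cone z -> dotC (qmap Q z) (qmap Q z) = 0) ->
  dotR (qmapR Q v) (qmapR Q v) = dotR v v *
   (dotR (qpolar Q e0 v - (2 * x) *: qmapR Q e0) (qpolar Q e0 v - (2 * x) *: qmapR Q e0)
    + 2 * dotR (qmapR Q e0) (qmapR Q v) - dotR (qmapR Q e0) (qmapR Q e0) * dotR v v).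
Proof.
move=> /(_ _ slice_cone); rewrite qmap_slice dotC_cplx => /complex_eq0.
move=> -[h1 h2]; rewrite !dotE in h1 h2.
have -> : qpolar Q e0 v - (2 * x) *: qmapR Q e0 = qpolar Q e0 y.
  by rewrite pvE addrAC subrr add0r.
rewrite vv GvE !dotE.
have C1 := dotRC (qmapR Q y) (qmapR Q e0).
have C2 := dotRC (qpolar Q e0 y) (qmapR Q e0).
have C3 := dotRC (qpolar Q e0 y) (qmapR Q y).
rewrite C1 in h1; rewrite C2 C3 in h2 *; rewrite C1.
have E1 : dotR (qmapR Q y) (qmapR Q y) = 2 * r ^+ 2 * dotR (qmapR Q e0) (qmapR Q y)
  - r ^+ 4 * dotR (qmapR Q e0) (qmapR Q e0) + r ^+ 2 * dotR (qpolar Q e0 y) (qpolar Q e0 y).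
  have -> : r ^+ 4 = r ^+ 2 * r ^+ 2 by ring.
  by rewrite !expr2 in h1 *; lra.
have E2 : dotR (qmapR Q y) (qpolar Q e0 y) =
    r ^+ 2 * dotR (qmapR Q e0) (qpolar Q e0 y).
  have [rz|rn0] := eqVneq r 0.
    by rewrite (r0 rz) qpolar0r !dotR0 mulr0.
  by apply: (mulfI rn0); rewrite !expr2 in h2 *; lra.
rewrite E1 E2; ring.
Qed.

End Slice.

Definition qform (M : 'I_n -> 'I_n -> R) v : R :=
  \sum_i \sum_j M i j * v 0 i * v 0 j.

Definition is_qform (f : V -> R) := exists M, forall v, f v = qform M v.

Lemma is_qformD f g : is_qform f -> is_qform g -> is_qform (fun v => f v + g v).
Proof.
move=> [M fM] [N gN]; exists (fun i j => M i j + N i j) => v.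
rewrite fM gN /qform -big_split; apply: eq_bigr => i _.
by rewrite -big_split; apply: eq_bigr => j _; rewrite !mulrDl.
Qed.

Lemma is_qformZ a f : is_qform f -> is_qform (fun v => a * f v).
Proof.
move=> [M fM]; exists (fun i j => a * M i j) => v.
rewrite fM /qform mulr_sumr; apply: eq_bigr => i _.
by rewrite mulr_sumr; apply: eq_bigr => j _; rewrite !mulrA.
Qed.

Lemma is_qform_sum (I : finType) (F : I -> V -> R) : (forall i, is_qform (F i)) ->
  is_qform (fun v => \sum_i F i v).
Proof.
move=> H; elim: (index_enum I) => [|i s [M IH]].
  exists (fun _ _ => 0) => v; rewrite big_nil /qform big1// => i _.
  by rewrite big1// => j _; rewrite !mul0r.
have [N HN] := is_qformD (H i) (ex_intro _ M IH).
by exists N => v; rewrite big_cons; exact: HN.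
Qed.

Lemma is_qform_mul (f g : V -> R) : (forall a u w, f (a *: u + w) = a * f u + f w) ->
  (forall a u w, g (a *: u + w) = a * g u + g w) -> is_qform (fun v => f v * g v).
Proof.
move=> /linform_ex [l fl] /linform_ex [m gm]; exists (fun i j => l i * m j) => v.
rewrite fl gm /linform /qform mulr_suml; apply: eq_bigr => i _.
by rewrite mulr_sumr; apply: eq_bigr => j _; ring.
Qed.

Lemma cone_cubic Q : (forall z, asym_cone z -> dotC z (qmap Q z) = 0) ->
  exists l, forall v, dotR v (qmapR Q v) = dotR v v * linform l v.
Proof.
(* A unit vector [e0] exists only for [n > 0]; for [n = 0] all sums are empty. *)
move=> H; have [i0 _|no] := pickP (@predT 'I_n); last first.
  exists (fun=> 0) => v.
  by rewrite /dotR !big1 ?mul0r// => i _; have := no i.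
pose e0 := e_ R i0.
have e0e0 : dotR e0 e0 = 1 by rewrite dotR_e /e0 /e_ mxE !eqxx.
have [l Hl] : exists l, forall v, dotR e0 (qpolar Q e0 v) + dotR v (qmapR Q e0) -
    2 * dotR e0 v * dotR e0 (qmapR Q e0) = linform l v.
  apply: (@linform_ex (fun v => dotR e0 (qpolar Q e0 v) + dotR v (qmapR Q e0) -
    2 * dotR e0 v * dotR e0 (qmapR Q e0))) => a u w.
  by rewrite qpolarDr qpolarZr !dotE; ring.
exists l => v; rewrite -Hl.
apply: (@slice_cubic Q e0 (v - dotR e0 v *: e0) v (dotR e0 v)
  (Num.sqrt (dotR (v - dotR e0 v *: e0) (v - dotR e0 v *: e0)))) => //.
- by rewrite !dotE e0e0 mulr1 subrr.
- by rewrite sqr_sqrtr// dotR_ge0.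
- by rewrite addrC subrK.
Qed.

Lemma cone_quartic Q : (forall z, asym_cone z -> dotC (qmap Q z) (qmap Q z) = 0) ->
  exists M, forall v, dotR (qmapR Q v) (qmapR Q v) = dotR v v * qform M v.
Proof.
move=> H; have [i0 _|no] := pickP (@predT 'I_n); last first.
  exists (fun _ _ => 0) => v.
  by rewrite /dotR !big1 ?mul0r// => i _; have := no i.
pose e0 := e_ R i0; pose G0 := qmapR Q e0.
have e0e0 : dotR e0 e0 = 1 by rewrite dotR_e /e0 /e_ mxE !eqxx.
pose L v := qpolar Q e0 v - (2 * dotR e0 v) *: G0.
have LD a u w : L (a *: u + w) = a *: L u + L w.
  rewrite /L /G0 qpolarDr qpolarZr !dotE.
  move: (qpolar Q e0 u) (qpolar Q e0 w) (qmapR Q e0) => p p' g.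
  by apply/rowP => k; rewrite !mxE; ring.
have qdot (F F' : V -> V) : (forall a u w, F (a *: u + w) = a *: F u + F w) ->
    (forall a u w, F' (a *: u + w) = a *: F' u + F' w) ->
    is_qform (fun v => dotR (F v) (F' v)).
  move=> HF HF'; apply: is_qform_sum => k; apply: is_qform_mul => a u w.
    by rewrite HF !mxE.
  by rewrite HF' !mxE.
have qG : is_qform (fun v => dotR G0 (qmapR Q v)).
  apply: is_qform_sum => k; apply: is_qformZ.
  by exists (Q k) => v; rewrite mxE.
have [M HM] : is_qform (fun v => dotR (L v) (L v) + (2 * dotR G0 (qmapR Q v) +
    (- dotR G0 G0) * dotR v v)).
  apply: is_qformD (qdot _ _ LD LD) (is_qformD (is_qformZ _ qG) (is_qformZ _ _)).
  exact: (qdot id id).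
exists M => v; rewrite -HM addrA mulNr.
apply: (@slice_quartic Q e0 (v - dotR e0 v *: e0) v (dotR e0 v)
  (Num.sqrt (dotR (v - dotR e0 v *: e0) (v - dotR e0 v *: e0)))) => //.
- by rewrite !dotE e0e0 mulr1 subrr.
- by rewrite sqr_sqrtr// dotR_ge0.
- by rewrite addrC subrK.
Qed.

(** Pluecker coordinates of [a] and [b]. Equality modulo multiples of [d] is tested by the wedges
    with [d]. *)
Definition wedge {F : pzRingType} (a b : 'rV[F]_n) (j k : 'I_n) : F :=
  a 0 j * b 0 k - a 0 k * b 0 j.

Lemma wedge_dotC (a c z : VC) k : (forall j, wedge a z j k = 0) ->
  dotC c a * z 0 k = a 0 k * dotC c z.
Proof.
move=> H; apply/eqP; rewrite -subr_eq0; apply/eqP.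
rewrite /dotC mulr_suml mulr_sumr -sumrB big1// => j _.
have := H j; rewrite /wedge => Hj.
by rewrite -[RHS](mulr0 (c 0 j)) -Hj; ring.
Qed.

Lemma complexified_wedge (F F' : V -> V) (G G' : VC -> VC) j k :
  (forall k, complexified (fun v => F v 0 k) (fun z => G z 0 k)) ->
  (forall k, complexified (fun v => F' v 0 k) (fun z => G' z 0 k)) ->
  complexified (fun v => wedge (F v) (F' v) j k) (fun z => wedge (G z) (G' z) j k).
Proof. by move=> H H'; apply: complexifiedB; exact: complexifiedM. Qed.

Lemma qmap0 Q : qmap Q 0 = 0.
Proof.
apply/rowP => k; rewrite !mxE big1// => i _; rewrite big1// => j _.
by rewrite !mxE mulr0.
Qed.

Section Jets.
Variables (Q : quad_coeffs R n) (g3 g4 : V -> V) (h3 h4 : VC -> VC).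
Hypothesis gh3 : forall k, complexified (fun v => g3 v 0 k) (fun z => h3 z 0 k).
Hypothesis gh4 : forall k, complexified (fun v => g4 v 0 k) (fun z => h4 z 0 k).
Hypothesis E3 : forall v j k, dotR v v * wedge (g3 v) v j k =
  12 * dotR v (qmapR Q v) * wedge (qmapR Q v) v j k.
Hypothesis E4 : forall v j k, dotR v v * wedge (g4 v) v j k =
  (24 * dotR (qmapR Q v) (qmapR Q v) + 8 * dotR v (g3 v)) * wedge (qmapR Q v) v j k.

Let cid k : complexified (fun v : V => v 0 k) (fun z : VC => z 0 k).
Proof. exact: complexified_coord. Qed.

Let cQ k : complexified (fun v => qmapR Q v 0 k) (fun z => qmap Q z 0 k).
Proof. exact: complexified_qmap. Qed.

(** If [s] were nonzero, [a] and [z] would have zero wedge; contracting it with [c] gives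
    [s z = (c, z) a = 0], hence [z = 0] and [s = 0]. *)
Let vanish (s : C) (a c z : VC) : (forall j k, s * wedge a z j k = 0) ->
  dotC c a = s -> dotC c z = 0 -> (z = 0 -> s = 0) -> s = 0.
Proof.
move=> H cs cz zs; apply/eqP/negPn/negP => sn0.
have W j k : wedge a z j k = 0.
  by apply/eqP; have /eqP := H j k; rewrite mulf_eq0 (negbTE sn0).
have z0 : z = 0.
  apply/rowP => k; rewrite mxE; apply: (mulfI sn0).
  by rewrite -cs (wedge_dotC _ (W^~ k)) cz !mulr0.
by rewrite (zs z0) eqxx in sn0.
Qed.

Let rcn0 (m : nat) : rc m.+1%:R != 0.
Proof. by rewrite rmorph_nat pnatr_eq0. Qed.

Let cone_dot z : asym_cone z -> dotC z (qmap Q z) = 0.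
Proof.
move=> z0; have z0' : dotC z z = 0 := z0.
have E (z' : VC) j k : dotC z' z' * wedge (h3 z') z' j k -
    rc 12 * dotC z' (qmap Q z') * wedge (qmap Q z') z' j k = 0.
  move: z'; apply: complexified_eq0 (fun v => dotR v v * wedge (g3 v) v j k -
    12 * dotR v (qmapR Q v) * wedge (qmapR Q v) v j k) _ _ _ => [|v].
    apply: complexifiedB; apply: complexifiedM.
    - exact: complexified_dot.
    - exact: complexified_wedge.
    - by apply: complexifiedM; [exact: complexified_cst|exact: complexified_dot].
    - exact: complexified_wedge.
  by rewrite E3 subrr.
apply: (vanish (a := qmap Q z) (c := z) (z := z)) => // [j k|z00].
  apply: (mulfI (rcn0 11)); have := E z j k.
  by rewrite z0' mul0r sub0r mulr0 mulrA => /eqP; rewrite oppr_eq0 => /eqP.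
by rewrite z00 /dotC big1// => i _; rewrite mxE mul0r.
Qed.

(** Restricted to the cone, [E3] says nothing about [h3]. But [cone_cubic] makes its right side
    divisible by [(v, v)], and the quotient identity extends to all complex [z]:
    [h3 z - 12 l(z) Q z] has zero wedge with [z]. Contracting with [z], which is orthogonal to
    [Q z], gives the claim. *)
Let cone_dot3 z : asym_cone z -> dotC z (h3 z) = 0.
Proof.
move=> z0; have z0' : dotC z z = 0 := z0.
have [->|zn0] := eqVneq z 0.
  by rewrite /dotC big1// => i _; rewrite mxE mul0r.
have [l Hl] := cone_cubic cone_dot.
pose lC (z : VC) := \sum_i rc (l i) * z 0 i.
have cl : complexified (linform l) lC.
  by apply: complexified_sum => i; apply: complexifiedM => //; exact: complexified_cst.
have E (z' : VC) j k : wedge (h3 z') z' j k -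
    rc 12 * lC z' * wedge (qmap Q z') z' j k = 0.
  move: z'; apply: complexified_eq0 (fun v => wedge (g3 v) v j k -
    12 * linform l v * wedge (qmapR Q v) v j k) _ _ _ => [|v].
    apply: complexifiedB; first exact: complexified_wedge.
    apply: complexifiedM; last exact: complexified_wedge.
    by apply: complexifiedM => //; exact: complexified_cst.
  have [->|vn0] := eqVneq v 0; first by rewrite /wedge !mxE; ring.
  apply: (mulfI (lt0r_neq0 (dotR_gt0 vn0))); rewrite mulrBr E3 Hl mulr0; ring.
have [k zk] : exists k, z 0 k != 0.
  apply/existsP; rewrite -negb_forall; apply: contra zn0 => /forallP H.
  by apply/eqP/rowP => k; rewrite mxE; exact/eqP.
pose a : VC := h3 z - (rc 12 * lC z) *: qmap Q z.
have W j : wedge a z j k = 0.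
  rewrite -[RHS](E z j k) /wedge /a.
  by move: (h3 z) (qmap Q z) => p p'; rewrite !mxE; ring.
have := wedge_dotC z W; rewrite z0' mulr0 => /eqP.
rewrite mulf_eq0 (negbTE zk) orbF => /eqP.
have -> : dotC z a = dotC z (h3 z) - rc 12 * lC z * dotC z (qmap Q z).
  rewrite /dotC mulr_sumr -sumrB; apply: eq_bigr => i _.
  by rewrite /a; move: (h3 z) (qmap Q z) => p p'; rewrite !mxE; ring.
by rewrite (cone_dot z0) mulr0 subr0.
Qed.

(** [cone_dot3] removes the third jet from [E4]; there remains [24 (Q z, Q z)] times the wedge of
    [Q z] and [z]. So [vanish] applies with [c = Q z], orthogonal to [z] by [cone_dot]. *)
Lemma jets_in_Vn : in_Vn Q.
Proof.
move=> z z0; have z0' : dotC z z = 0 := z0; split; first exact: cone_dot.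
have E (z' : VC) j k : dotC z' z' * wedge (h4 z') z' j k -
    (rc 24 * dotC (qmap Q z') (qmap Q z') + rc 8 * dotC z' (h3 z'))
       * wedge (qmap Q z') z' j k = 0.
  move: z'; apply: complexified_eq0 (fun v => dotR v v * wedge (g4 v) v j k -
    (24 * dotR (qmapR Q v) (qmapR Q v) + 8 * dotR v (g3 v))
      * wedge (qmapR Q v) v j k) _ _ _ => [|v].
    apply: complexifiedB; apply: complexifiedM.
    - exact: complexified_dot.
    - exact: complexified_wedge.
    - by apply: complexifiedD; apply: complexifiedM;
        [exact: complexified_cst|exact: complexified_dot|
         exact: complexified_cst|exact: complexified_dot].
    - exact: complexified_wedge.
  by rewrite E4 subrr.
apply: (vanish (a := qmap Q z) (c := qmap Q z) (z := z)) => // [j k||z00].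
- apply: (mulfI (rcn0 23)); have := E z j k; rewrite z0' cone_dot3// mul0r sub0r.
  by rewrite !mulr0 addr0 mulrA => /eqP; rewrite oppr_eq0 => /eqP.
- by rewrite -[RHS](cone_dot z0) /dotC; apply: eq_bigr => i _; rewrite mulrC.
- by rewrite z00 qmap0 /dotC big1// => i _; rewrite mxE mul0r.
Qed.

End Jets.

End Cone.

(** * Circles through the origin *)

Section Circles.
Context {R : realType} {n : nat}.
Local Notation V := 'rV[R]_n.
Implicit Types (u v w x d N : V) (K : set V) (a b r s t : R).

Lemma cos_sin_ex a b : a ^+ 2 + b ^+ 2 = 1 -> exists t, cos t = a /\ sin t = b.
Proof.
move=> ab.
have a1 : -1 <= a <= 1.
  rewrite -ler_norml -(@ler_pXn2r _ 2) ?nnegrE// real_normK ?num_real//.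
  by rewrite expr1n -ab lerDl sqr_ge0.
have sE : Num.sqrt (1 - a ^+ 2) = `|b| by rewrite -ab addrAC subrr add0r sqrtr_sqr.
have [b0|b0] := leP 0 b.
  by exists (acos a); rewrite acosK// sin_acos// sE ger0_norm.
exists (- acos a); rewrite cosN sinN acosK// sin_acos// sE ltr0_norm//.
by rewrite opprK.
Qed.

(* For [N] orthogonal to [d], the circle through 0 tangent to [d] whose
   curvature vector is [2 N / |d|^2]; only the class of [N] modulo [d] matters,
   and [N = 0] gives the line. *)
Definition osc_circle d N : set V :=
  [set x | exists a, x = a *: d + (dotR x x / dotR d d) *: N].

Lemma wedge_comb a b d N j k :
  wedge (a *: d + b *: N) d j k = b * wedge N d j k.
Proof. by rewrite /wedge !mxE; ring. Qed.

Lemma wedge_eq0 u d : d != 0 -> (forall j k, wedge u d j k = 0) ->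
  exists a, u = a *: d.
Proof.
move=> dn0 H.
have [k dk] : exists k, d 0 k != 0.
  apply/existsP; rewrite -negb_forall; apply: contra dn0 => /forallP H0.
  by apply/eqP/rowP => k; rewrite mxE; exact/eqP.
exists (u 0 k / d 0 k); apply/rowP => j; rewrite mxE mulrAC.
have /eqP := H j k; rewrite /wedge subr_eq0 => /eqP <-.
by rewrite mulfK.
Qed.

(** Wedging with [d] eliminates the free coefficient [a]. This is the form of the circle equation
    that gets differentiated. *)
Lemma osc_circleP d N x : d != 0 -> osc_circle d N x <->
  forall j k, dotR d d * wedge x d j k = dotR x x * wedge N d j k.
Proof.
move=> dn0; have dd := lt0r_neq0 (dotR_gt0 dn0); split.
  case=> a xE j k; rewrite {1}xE wedge_comb mulrA [X in X * _]mulrCA.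
  by rewrite mulfV// mulr1.
move=> H; have [j k|a aE] := @wedge_eq0 (x - (dotR x x / dotR d d) *: N) d dn0.
  apply: (mulfI dd); rewrite mulr0.
  rewrite (_ : wedge _ _ _ _ = wedge x d j k - dotR x x / dotR d d * wedge N d j k).
    by rewrite mulrBr H mulrA mulrCA mulfV// mulr1 subrr.
  by rewrite /wedge !mxE; ring.
by exists a; rewrite -aE subrK.
Qed.

Lemma osc_circle0 d N : osc_circle d N 0.
Proof. by exists 0; rewrite dot0R mul0r !scale0r addr0. Qed.

Lemma osc_circle_eq d N N' : d != 0 ->
  (forall j k, wedge N d j k = wedge N' d j k) -> osc_circle d N = osc_circle d N'.
Proof.
move=> dn0 H; apply/seteqP; split=> x /osc_circleP => /(_ dn0) Hx;
  by apply/osc_circleP => // j k; rewrite Hx H.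
Qed.

(** A quadratic map satisfies [Gam (s d) = s^2 Gam d], so by this scaling [osc_circle d (Gam d)]
    depends only on the line spanned by [d]. *)
Lemma osc_circleZ s d N : s != 0 ->
  osc_circle (s *: d) (s ^+ 2 *: N) = osc_circle d N.
Proof.
move=> s0; have E x : dotR x x / dotR (s *: d) (s *: d) * s ^+ 2 = dotR x x / dotR d d.
  have [->|dn0] := eqVneq d 0; first by rewrite !scaler0 !dot0R invr0; ring.
  have dd := lt0r_neq0 (dotR_gt0 dn0).
  by rewrite dotRZl dotRZr; field; rewrite s0 dd.
apply/seteqP; split=> x [a xE].
  by exists (a * s); rewrite {1}xE !scalerA E.
by exists (a / s); rewrite {1}xE !scalerA E divfK.
Qed.

Lemma osc_circle_orth d N : d != 0 -> exists N', [/\ dotR d N' = 0,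
  osc_circle d N = osc_circle d N' & forall j k, wedge N d j k = wedge N' d j k].
Proof.
move=> dn0; have dd := lt0r_neq0 (dotR_gt0 dn0).
exists (N - (dotR d N / dotR d d) *: d).
have W j k : wedge N d j k = wedge (N - (dotR d N / dotR d d) *: d) d j k.
  by rewrite /wedge !mxE; ring.
split=> //; last exact: osc_circle_eq.
by rewrite !dotE divfK// subrr.
Qed.

(** Rational parametrisation of the circle by inversion: for [N] orthogonal to [d] and [t] nonzero,
    [x / |x|^2] equals [(t^-1 d + N) / |d|^2], which moves on a line. *)
Definition osc_point d N t : V :=
  (1 + t ^+ 2 * (dotR N N / dotR d d))^-1 *: (t *: d + t ^+ 2 *: N).

Lemma osc_point_den d N t : 1 + t ^+ 2 * (dotR N N / dotR d d) != 0.
Proof.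
by rewrite lt0r_neq0// ltr_pwDl// mulr_ge0 ?sqr_ge0// divr_ge0 ?dotR_ge0.
Qed.

Lemma dotR_osc_point d N t : d != 0 -> dotR d N = 0 ->
  dotR (osc_point d N t) (osc_point d N t) =
  (1 + t ^+ 2 * (dotR N N / dotR d d))^-1 * t ^+ 2 * dotR d d.
Proof.
move=> dn0 dN; have dd := lt0r_neq0 (dotR_gt0 dn0).
have D := osc_point_den d N t.
rewrite /osc_point !dotE (dotRC N) dN; field.
by rewrite dd; move: D; rewrite mulrA -(mulfV dd) -mulrDl mulf_eq0 negb_or => /andP[].
Qed.

Lemma osc_circle_point d N t : d != 0 -> dotR d N = 0 ->
  osc_circle d N (osc_point d N t).
Proof.
move=> dn0 dN; have dd := lt0r_neq0 (dotR_gt0 dn0).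
exists ((1 + t ^+ 2 * (dotR N N / dotR d d))^-1 * t).
rewrite dotR_osc_point// mulfK// /osc_point scalerDr !scalerA.
by [].
Qed.

Lemma osc_circle_sub d N d' N' : d != 0 -> d' != 0 -> dotR d N = 0 ->
  osc_circle d N `<=` osc_circle d' N' ->
  (forall j k, wedge d d' j k = 0) /\
  (d = d' -> forall j k, wedge N d j k = wedge N' d j k).
Proof.
move=> dn0 dn0' dN sub.
have dd := lt0r_neq0 (dotR_gt0 dn0); have dd' := lt0r_neq0 (dotR_gt0 dn0').
have H t j k : dotR d' d' * (t * wedge d d' j k + t ^+ 2 * wedge N d' j k) =
    t ^+ 2 * dotR d d * wedge N' d' j k.
  have := (osc_circleP _ _ dn0').1 (sub _ (osc_circle_point t dn0 dN)) j k.
  rewrite dotR_osc_point//; have := osc_point_den d N t.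
  set D := 1 + _ => D0.
  have -> : wedge (osc_point d N t) d' j k =
      D^-1 * (t * wedge d d' j k + t ^+ 2 * wedge N d' j k).
    by rewrite /wedge /osc_point -/D !mxE; ring.
  by rewrite mulrCA -!mulrA => /(mulfI (invr_neq0 D0)).
(* In [H] the tangent term is odd in [t] and the curvature terms are even; [t = 1] and [t = -1]
   separate them. *)
have W j k : wedge d d' j k = 0.
  apply: (mulfI dd'); have := H 1 j k; have := H (-1) j k.
  rewrite sqrrN expr1n => h1 h2; lra.
split=> // dE; subst d' => j k; have := H 1 j k.
by rewrite W mulr0 add0r expr1n !mul1r => /(mulfI dd).
Qed.

(** With centre [- r u] the [u]-component is [r (cos t - 1)] and [|x|^2 = 2 r^2 (1 - cos t)]; their
    ratio is the coefficient [- (2 r)^-1]. *)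
Lemma round_osc_circle c u w r : 0 < r -> dotR u u = 1 -> dotR w w = 1 ->
  dotR u w = 0 -> c + r *: u = 0 ->
  [set c + (r * cos t) *: u + (r * sin t) *: w | t in [set: R]] =
  osc_circle w (- (2 * r)^-1 *: u).
Proof.
move=> r0 uu ww uw /eqP; rewrite addr_eq0 => /eqP ->.
have rn0 := lt0r_neq0 r0.
have dpq p q : dotR (p *: u + q *: w) (p *: u + q *: w) = p ^+ 2 + q ^+ 2.
  by rewrite !dotE (dotRC w) uu ww uw; ring.
apply/seteqP; split=> x /=.
  move=> [t _ <-]; exists (r * sin t).
  have -> : - (r *: u) + (r * cos t) *: u = (r * (cos t - 1)) *: u.
    by rewrite -scaleNr -scalerDl; congr (_ *: _); ring.
  rewrite dpq ww divr1 addrC scalerA; congr (_ + _ *: _).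
  have -> : (r * (cos t - 1)) ^+ 2 + (r * sin t) ^+ 2 = r ^+ 2 * (2 - 2 * cos t).
    transitivity (r ^+ 2 * ((cos t ^+ 2 + sin t ^+ 2) - 2 * cos t + 1)); first by ring.
    by rewrite cos2Dsin2; ring.
  by field.
move=> [a]; rewrite ww divr1 scalerA; set X := dotR x x => xE.
have XE : X = a ^+ 2 + (X / (2 * r)) ^+ 2.
  rewrite {1}/X xE [a *: w + _]addrC dpq; ring.
have [t [ct st]] : exists t, cos t = 1 - X / (2 * r ^+ 2) /\ sin t = a / r.
  apply: cos_sin_ex.
  transitivity (1 + (a ^+ 2 + (X / (2 * r)) ^+ 2 - X) / r ^+ 2); first by field.
  by rewrite -XE subrr mul0r addr0.
exists t => //; rewrite xE ct st addrC; congr (_ + _).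
  by congr (_ *: _); field.
by rewrite -scaleNr -scalerDl; congr (_ *: _); field.
Qed.

Lemma osc_circle_line d : d != 0 -> osc_circle d 0 = [set t *: d | t in [set: R]].
Proof.
move=> dn0; apply/seteqP; split=> x /= [a].
  by rewrite scaler0 addr0 => ->; exists a.
by move=> _ <-; exists a; rewrite scaler0 addr0.
Qed.

Lemma unit_neq0 w : dotR w w = 1 -> w != 0.
Proof. by move=> ww; rewrite -dotR_eq0 ww oner_eq0. Qed.

Lemma tangent_osc_circle K d : tangent_at0 K d ->
  d != 0 /\ exists N, dotR d N = 0 /\ K = osc_circle d N.
Proof.
case=> [[v [-> [vn0 [dn0 [s vE]]]]]|].
  split=> //; exists 0; split; first exact: dotR0.
  have s0 : s != 0 by apply: contra vn0; rewrite vE => /eqP ->; rewrite scale0r.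
  rewrite -osc_circle_line// vE -{1}(scaler0 _ (s ^+ 2)); exact: osc_circleZ.
move=> [c [u [w [r [r0 [uu [ww [uw [cu [-> [wn0 [dn0 [s wE]]]]]]]]]]]]].
have s0 : s != 0 by apply: contra wn0; rewrite wE => /eqP ->; rewrite scale0r.
(* [round_osc_circle] treats the unit direction [w = s d]; [osc_circleZ] converts its vector to one
   for [d]. *)
split=> //; exists (s ^- 2 *: (- (2 * r)^-1 *: u)); split.
  rewrite !dotRZr; apply: (mulfI s0).
  by rewrite mulr0 !(mulrCA s) -dotRZl -wE dotRC uw !mulr0.
rewrite round_osc_circle// -(osc_circleZ d _ s0) -wE; congr (osc_circle _ _).
by rewrite scalerA mulfV ?scale1r// expf_neq0.
Qed.

Lemma osc_circle_tangent d N : d != 0 ->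
  is_circle (osc_circle d N) /\ tangent_at0 (osc_circle d N) d.
Proof.
move=> dn0; have [N' [dN -> _]] := osc_circle_orth N dn0.
have par : parallel d d by split=> //; split=> //; exists 1; rewrite scale1r.
have [->|Nn0] := eqVneq N' 0.
  split; last by left; exists d; split=> //; exact: osc_circle_line.
  right; exists 0, d; split=> //; rewrite osc_circle_line//.
  by congr image; apply/funext => t; rewrite add0r.
pose m := Num.sqrt (dotR N' N'); pose p := Num.sqrt (dotR d d).
have m0 : 0 < m by rewrite sqrtr_gt0 dotR_gt0.
have p0 : 0 < p by rewrite sqrtr_gt0 dotR_gt0.
have m2 : m ^+ 2 = dotR N' N' by rewrite sqr_sqrtr ?dotR_ge0.
have p2 : p ^+ 2 = dotR d d by rewrite sqr_sqrtr ?dotR_ge0.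
have mn0 := lt0r_neq0 m0; have pn0 := lt0r_neq0 p0.
(* For the unit direction [w] the vector must be [p^-2 N'] by [osc_circleZ] and [- (2 r)^-1 u] by
   [round_osc_circle]; this dictates [u] and [r]. *)
pose u := (- m^-1) *: N'; pose w := p^-1 *: d; pose r := p ^+ 2 / (2 * m).
have r0 : 0 < r by rewrite divr_gt0 ?exprn_gt0// mulr_gt0.
have uu : dotR u u = 1 by rewrite /u !dotE -m2; field.
have ww : dotR w w = 1 by rewrite /w !dotE -p2; field.
have uw : dotR u w = 0 by rewrite /u /w !dotE dotRC dN; ring.
have cu : - (r *: u) + r *: u = 0 by rewrite addNr.
have E : osc_circle d N' = [set - (r *: u) + (r * cos t) *: u + (r * sin t) *: w
    | t in [set: R]].
  rewrite round_osc_circle// -(osc_circleZ d _ (invr_neq0 pn0)); congr (osc_circle _ _).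
  rewrite /u scalerA; congr (_ *: _); rewrite /r; field.
  by rewrite pn0 mn0.
split; first by left; exists (- (r *: u)), u, w, r.
right; exists (- (r *: u)), u, w, r; do 6!split=> //.
split; first exact: unit_neq0.
by split=> //; exists p^-1.
Qed.

Lemma circle_has_tangent K : is_circle K -> K 0 -> exists d, tangent_at0 K d.
Proof.
case=> [[c [u [w [r [r0 [uu [ww [uw ->]]]]]]]] [t0 _ ct0]|[a [v [vn0 ->]]] [t0 _ at0]].
  (* The frame is rotated by the angle [t0] at which the circle meets 0, to reach the position
     [c + r u' = 0] required by [tangent_at0]. *)
  pose u' := cos t0 *: u + sin t0 *: w; pose w' := - sin t0 *: u + cos t0 *: w.
  have cs := cos2Dsin2 t0.
  have uu' : dotR u' u' = 1 by rewrite /u' !dotE (dotRC w) uu ww uw -[RHS]cs; ring.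
  have ww' : dotR w' w' = 1 by rewrite /w' !dotE (dotRC w) uu ww uw -[RHS]cs; ring.
  have uw' : dotR u' w' = 0 by rewrite /u' /w' !dotE (dotRC w) uu ww uw; ring.
  have cu' : c + r *: u' = 0 by rewrite -[RHS]ct0 /u' scalerDr !scalerA addrA.
  have wn0 := unit_neq0 ww'.
  exists w'; right; exists c, u', w', r; do 5!split=> //; split; last first.
    by split=> //; split=> //; exists 1; rewrite scale1r.
  have E s : c + (r * cos (s + t0)) *: u + (r * sin (s + t0)) *: w =
      c + (r * cos s) *: u' + (r * sin s) *: w'.
    rewrite cosD sinD /u' /w'; apply/rowP => k; rewrite !mxE; ring.
  apply/seteqP; split=> x /= [s _ <-].
    by exists (s - t0) => //; rewrite -E subrK.
  by exists (s + t0).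
exists v; left; exists v; split; last first.
  by split=> //; split=> //; exists 1; rewrite scale1r.
have aE : a = - t0 *: v by apply/eqP; rewrite scaleNr -addr_eq0; apply/eqP.
apply/seteqP; split=> x /= [s _ <-].
  by exists (s - t0) => //; rewrite aE -scalerDl addrC.
by exists (s + t0) => //; rewrite aE -scalerDl addrC addrK.
Qed.

End Circles.

(** * Jets of a normalized rectifier *)

Section ChainRule.
Context {R : realType} {n : nat}.
Local Notation V := 'rV[R]_n.

Lemma row_differentiable {W : normedModType R} (F : W -> V) (x : W) :
  (forall j, differentiable (fun y => F y 0 j : R) x) -> differentiable F x.
Proof.
move=> H; rewrite (_ : F = \sum_(j < n) (fun y => F y 0 j *: e_ R j)).
  apply: differentiable_sum => j; exact: differentiableZl.
by apply/funext => y; rewrite fct_sumE; exact: row_sum_e.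
Qed.

Lemma derive_comp {W : normedModType R} (F : W -> V) (f : V -> R) (x v : W) :
  differentiable F x -> differentiable f (F x) ->
  is_derive x v (f \o F) ('D_('D_v F x) f (F x)).
Proof.
move=> dF df; have dc := differentiable_comp dF df.
apply: DeriveDef; first exact: diff_derivable.
by rewrite !deriveE// diff_comp.
Qed.

Lemma smooth_on_differentiable U (F : V -> V) x : open U -> smooth_on U F -> U x ->
  differentiable F x.
Proof.
move=> oU sF Ux; apply: row_differentiable => j.
exact (smoothR_differentiable oU (smooth_on_coord j oU sF) Ux).
Qed.

Lemma smooth_on_derive U (F : V -> V) x v : open U -> smooth_on U F -> U x ->
  'D_v F x = \sum_i v 0 i *: 'D_(e_ R i) F x.
Proof.
move=> oU sF Ux; have dF := smooth_on_differentiable oU sF Ux.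
rewrite deriveE// {1}(row_sum_e v) linear_sum; apply: eq_bigr => i _.
by rewrite linearZ deriveE.
Qed.

End ChainRule.

Section RealGerms.
Context {R : realType}.
Implicit Types (h f : R -> R).

(** Derivative 1 at 0 gives [h t] the sign of [t] for small [t]; the intermediate value theorem on
    an interval [[-d, d]] inside [B] does the rest. *)
Lemma germ_surjective h (B : set R) : h 0 = 0 -> is_derive (0 : R) (1 : R) h 1 ->
  (\forall t \near (0 : R), {for t, continuous h}) -> (\forall t \near (0 : R), B t) ->
  \forall s \near (0 : R), exists t, B t /\ h t = s.
Proof.
move=> h0 [dh Dh] ch nB.
have L : (fun t : R => t^-1 *: (h (t *: (1 : R) + 0) - h 0)) @ 0^' --> 'D_1 h 0.
  exact dh.
rewrite Dh in L.
have pos : \forall t \near (0 : R), t != 0 -> 0 < t^-1 * h t.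
  have /cvgrPdist_lt/(_ _ ltr01) := L; rewrite near_withinE.
  apply: filterS => t /[swap] t0 /(_ t0).
  by rewrite [_%:A]mulr1 addr0 h0 subr0 ltr_norml => /andP[_]; rewrite /GRing.scale/=; lra.
have [e /= e0 He] := (nbhs_ballP _ _).1 (filterI pos (filterI ch nB)).
pose d := e / 2; have d0 : 0 < d by rewrite divr_gt0.
have dB t : - d <= t <= d -> ball (0 : R) e t.
  move=> /andP[t1 t2]; rewrite -ball_normE/= sub0r normrN ltr_norml.
  by apply/andP; rewrite /d in t1 t2 *; split; lra.
have Bd : - d <= d <= d by rewrite lexx andbT; lra.
have BNd : - d <= - d <= d by rewrite lexx; lra.
have hd : 0 < h d.
  have [/(_ (lt0r_neq0 d0)) pd _] := He _ (dB _ Bd).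
  by move: pd; rewrite pmulr_rgt0 ?invr_gt0.
have hNd : h (- d) < 0.
  have [+ _] := He _ (dB _ BNd).
  by rewrite oppr_eq0 => /(_ (lt0r_neq0 d0)); rewrite nmulr_rgt0// invr_lt0 oppr_lt0.
have cw : {within `[- d, d], continuous h}.
  apply: continuous_in_subspaceT => t; rewrite inE/= in_itv/= => /dB /He[_ [ct _]].
  exact: ct.
have dd : - d <= d by lra.
near=> s.
have sI : Num.min (h (- d)) (h d) <= s <= Num.max (h (- d)) (h d).
  rewrite ge_min le_max; apply/andP; split; apply/orP; [left|right].
    by apply: ltW; near: s; exact: lt_nbhsr.
  by apply: ltW; near: s; exact: lt_nbhsl.
have [t] := IVT dd cw sI.
rewrite in_itv/= => /dB /He[_ [_ Bt]] hts.
by exists t.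
Unshelve. all: by end_near. Qed.

(** Both hypothesis and conclusion hold on a neighbourhood, not just at 0, so a relation can be
    differentiated repeatedly. *)
Lemma near0_derive f (f' : R -> R) : (\forall t \near (0 : R), f t = 0) ->
  (\forall t \near (0 : R), is_derive t (1 : R) f (f' t)) ->
  \forall t \near (0 : R), f' t = 0.
Proof.
move=> f0 df; have ff := near_join f0; near=> t.
have [_ <-] : is_derive t (1 : R) f (f' t) by near: t.
rewrite -(derive_cst (0 : R) t (1 : R)); apply: near_eq_derive.
by near: t.
Unshelve. all: by end_near. Qed.

End RealGerms.

Section DirectionalJets.
Context {R : realType} {n : nat}.
Local Notation V := 'rV[R]_n.

Lemma dernS m v (f : V -> R) : dern m.+1 v f = dern m v ('D_v f).
Proof. by rewrite /dern iterSr. Qed.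

Lemma dernS_sum U m v (f : V -> R) x : open U -> smoothR U f -> U x ->
  dern m.+1 v f x = \sum_i v 0 i * dern m v ('D_(e_ R i) f) x.
Proof.
move=> oU sf Ux; rewrite dernS.
have sD i : smoothR U ('D_(e_ R i) f) := @smoothR_derive _ _ U f i sf.
rewrite -(@dern_sum _ _ U _ (fun i => v 0 i) _ v m x oU sD Ux).
by apply: (dern_ext _ _ oU) => // y Uy; exact: smoothR_deriveE oU sf Uy.
Qed.

(** Each derivative along [v] brings one factor linear in [v] ([dernS_sum]), so the jets at a point
    are polynomial in the direction and extend to complex vectors. *)
Lemma complexified_dern U m (f : V -> R) x : open U -> smoothR U f -> U x ->
  exists g, complexified (fun v => dern m v f x) g.
Proof.
move=> oU + Ux; elim: m f => [|m IH] f sf.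
  by exists (fun=> real_complex R (f x)); exact: complexified_cst.
pose G i := sval (cid (IH _ (@smoothR_derive _ _ U f i sf))).
have HG i : complexified (fun v => dern m v ('D_(e_ R i) f) x) (G i).
  exact: svalP (cid (IH _ (@smoothR_derive _ _ U f i sf))).
exists (fun z : 'rV[R[i]]_n => \sum_i z 0 i * G i z).
rewrite (_ : (fun v => _) = (fun v : V => \sum_i v 0 i * dern m v ('D_(e_ R i) f) x)).
  apply: complexified_sum => i; apply: complexifiedM; last exact: HG.
  exact: complexified_coord.
by apply/funext => v; exact: dernS_sum oU sf Ux.
Qed.

Lemma dern2_quad_part U (F : V -> V) v k : open U -> smooth_on U F -> U 0 ->
  dern 2 v (fun x => F x 0 k) 0 = 2 * qmapR (quad_part F) v 0 k.
Proof.
move=> oU sF U0; have sk := smooth_on_coord k oU sF.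
rewrite (dernS_sum _ _ oU sk U0) mxE exchange_big/= mulr_sumr.
apply: eq_bigr => j _.
rewrite (smoothR_deriveE _ oU (@smoothR_derive _ _ U _ j sk) U0) !mulr_sumr.
apply: eq_bigr => i _; rewrite (quad_partE _ _ _ oU sF U0).
by field.
Qed.

End DirectionalJets.

Section OscPoint.
Context {R : realType} {n : nat}.
Local Notation V := 'rV[R]_n.
Variables (d N : V).

Lemma osc_point0 : osc_point d N 0 = 0.
Proof. by rewrite /osc_point expr0n !scale0r addr0 scaler0. Qed.

Let m := dotR N N / dotR d d.

Let osc_coordE j : (fun t : R => osc_point d N t 0 j) =
  (fun t => (1 + t ^+ 2 * m)^-1 * (t * (d 0 j + t * N 0 j))).
Proof. by apply/funext => t; rewrite /osc_point -/m !mxE; ring. Qed.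

Let cden : continuous (fun t : R => (1 + t ^+ 2 * m)^-1).
Proof.
move=> t; apply: cvgV; first exact: osc_point_den.
apply: cvgD; first exact: cvg_cst.
by apply: cvgMr_tmp; exact: exprn_continuous.
Qed.

Let cnum j : continuous (fun t : R => d 0 j + t * N 0 j).
Proof.
move=> t; apply: cvgD; first exact: cvg_cst.
by apply: cvgMr_tmp; exact: cvg_id.
Qed.

Lemma osc_point_continuous : continuous (osc_point d N).
Proof.
move=> t; apply: row_continuous => j; rewrite osc_coordE.
apply: cvgM; first exact: cden.
by apply: cvgM; [exact: cvg_id|exact: cnum].
Qed.

Lemma osc_point_derive : is_derive (0 : R) (1 : R) (osc_point d N) d.
Proof.
have H j : is_derive (0 : R) (1 : R) (fun t => osc_point d N t 0 j) (d 0 j).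
  have E : (fun h : R => h^-1 *: ((osc_point d N (h *: (1 : R) + 0) 0 j) -
      osc_point d N 0 0 j)) @ 0^' --> d 0 j.
    have c : (fun t : R => (1 + t ^+ 2 * m)^-1 * (d 0 j + t * N 0 j)) @ 0^' --> d 0 j.
      have : {for (0 : R), continuous
          (fun t : R => (1 + t ^+ 2 * m)^-1 * (d 0 j + t * N 0 j))}.
        by apply: cvgM; [exact: cden|exact: cnum].
      move=> /continuous_withinNx.
      by rewrite expr0n !mul0r !addr0 invr1 mul1r.
    apply: cvg_trans c; apply: near_eq_cvg; near=> h.
    rewrite osc_point0 [_%:A]mulr1 addr0 [X in _ - X]mxE subr0.
    rewrite -[osc_point _ _ _ _ _]/((fun t => osc_point d N t 0 j) h) osc_coordE.
    have hn0 : h != 0 by near: h; exact: nbhs_dnbhs_neq.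
    by have := osc_point_den d N h; rewrite -/m /GRing.scale/= => D0; field; rewrite D0 hn0.
  by apply: DeriveDef; [apply/cvg_ex; exists (d 0 j)|exact: cvg_lim E].
have D : derivable (osc_point d N) 0 1.
  by apply/derivable_mxP => i j; rewrite ord1; have [] := H j.
apply: DeriveDef => //; apply/rowP => j.
by rewrite derive_mx// mxE; have [] := H j.
Unshelve. all: by end_near. Qed.

End OscPoint.

Section Diffeo.
Context {R : realType} {n : nat}.
Local Notation V := 'rV[R]_n.
Variables (U : set V) (F G : V -> V).
Hypothesis FG : diffeo_germ0 U F G.

Let oU : open U := FG.1.
Let U0 : U 0 := FG.2.1.
Let F0 : F 0 = 0 := FG.2.2.1.
Let oFU : open (F @` U) := FG.2.2.2.1.
Let sF : smooth_on U F := FG.2.2.2.2.1.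
Let sG : smooth_on (F @` U) G := FG.2.2.2.2.2.1.
Let GF : forall x, U x -> G (F x) = x := FG.2.2.2.2.2.2.1.
Let FGy : forall y, (F @` U) y -> F (G y) = y := FG.2.2.2.2.2.2.2.

Lemma diffeo_im0 : (F @` U) 0. Proof. by exists 0. Qed.

Lemma diffeo_inv0 : G 0 = 0. Proof. by rewrite -{1}F0 GF. Qed.

Lemma diffeo_inv_im : G @` (F @` U) = U.
Proof.
apply/seteqP; split=> x /=; first by move=> [_ [y Uy <-] <-]; rewrite GF.
by move=> Ux; exists (F x); [exists x|exact: GF].
Qed.

Lemma diffeo_germ_inv : diffeo_germ0 (F @` U) G F.
Proof.
split=> //; split; first exact: diffeo_im0.
by split; [exact: diffeo_inv0|rewrite diffeo_inv_im].
Qed.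

Let dF0 : differentiable F 0 := smooth_on_differentiable oU sF U0.
Let dG0 : differentiable G 0 := smooth_on_differentiable oFU sG diffeo_im0.

Lemma diffeo_deriveK v : 'D_('D_v F 0) G 0 = v.
Proof.
have dG : differentiable G (F 0) by rewrite F0.
have E : 'D_v (G \o F) 0 = v.
  rewrite -[RHS](derive_id (0 : V) v); apply: near_eq_derive; near=> x.
  by rewrite /= GF//; near: x; exact: near_open.
rewrite -[RHS]E (@deriveE _ _ _ _ 0 v (differentiable_comp dF0 dG)) diff_comp//=.
by rewrite F0 (@deriveE _ _ _ F 0 v dF0) (@deriveE _ _ _ G 0 _ dG0).
Unshelve. all: by end_near. Qed.

End Diffeo.

(** * A normalized rectifier sends short rays into circles *)

Section Rectifier.
Context {R : realType} {n : nat}.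
Local Notation V := 'rV[R]_n.
Variables (S : set (set V)) (U : set V) (Phi Psi : V -> V).
Hypothesis nr : normalized_rectifier S U Phi Psi.

Let dg : diffeo_germ0 U Phi Psi := nr.1.
Let oU : open U := dg.1.
Let U0 : U 0 := dg.2.1.
Let Phi0 : Phi 0 = 0 := dg.2.2.1.
Let oO : open (Phi @` U) := dg.2.2.2.1.
Let sPhi : smooth_on U Phi := dg.2.2.2.2.1.
Let sPsi : smooth_on (Phi @` U) Psi := dg.2.2.2.2.2.1.
Let PhiPsi : forall y, (Phi @` U) y -> Phi (Psi y) = y := dg.2.2.2.2.2.2.2.
Let O0 : (Phi @` U) 0 := diffeo_im0 dg.
Let Psi0 : Psi 0 = 0 := diffeo_inv0 dg.

Lemma normalized_derive v : 'D_v Phi 0 = v.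
Proof.
rewrite (smooth_on_derive _ oU sPhi U0) [RHS]row_sum_e.
by apply: eq_bigr => i _; rewrite nr.2.1.
Qed.

Lemma normalized_derive_inv v : 'D_v Psi 0 = v.
Proof. by rewrite -{1}(normalized_derive v) (diffeo_deriveK dg). Qed.

(** The hypothesis only puts [Psi] of the circle inside some line. It remains to see that this line
    has direction [d], and that the image covers a neighbourhood of 0 in it, so that each small
    [s d] is [Psi] of a point of the circle. *)
Lemma rectifier_circle d N : d != 0 -> dotR d N = 0 -> S (osc_circle d N) ->
  \forall s \near (0 : R), osc_circle d N (Phi (s *: d)).
Proof.
move=> dn0 dN SK; have dd := lt0r_neq0 (dotR_gt0 dn0).
have [W [oW [W0 [WO [L [[a [v [vn0 LE]]] KL]]]]]] := nr.2.2 _ SK.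
pose k := osc_point d N.
have kK t : osc_circle d N (k t) by exact: osc_circle_point.
have k0 : k 0 = 0 := osc_point0 d N.
have kc : continuous k by exact: osc_point_continuous.
have kW : \forall t \near (0 : R), W (k t).
  by apply: kc; rewrite k0; exact: near_open.
(* The line contains [Psi 0 = 0], so its points are multiples of [v]. *)
have [c0 ac0] : exists c, a + c *: v = 0.
  have : L (Psi 0) by apply: KL; exists 0 => //; split=> //; exact: osc_circle0.
  by rewrite LE Psi0 => -[c _ ac]; exists c.
have Lk t : W (k t) -> exists c, Psi (k t) = c *: v.
  move=> Wt; have : L (Psi (k t)) by apply: KL; exists (k t).
  rewrite LE => -[c _ <-]; exists (c - c0).
  by rewrite scalerBl addrC; congr (_ + _); apply/eqP; rewrite -addr_eq0 ac0.
pose f j (x : V) : R := Psi x 0 j.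
have sf j : smoothR (Phi @` U) (f j) by exact: smooth_on_coord.
have dk : differentiable k 0.
  by apply/derivable1_diffP; have [] := osc_point_derive d N.
have dg0 j : is_derive (0 : R) (1 : R) (f j \o k) (d 0 j).
  have dfk : differentiable (f j) (k 0).
    by rewrite k0; exact (smoothR_differentiable oO (sf j) O0).
  have := derive_comp (1 : R) dk dfk.
  have [_ ->] := osc_point_derive d N; rewrite k0.
  rewrite -(row_derive j (@diff_derivable _ _ _ Psi 0 d (smooth_on_differentiable oO sPsi O0))).
  by rewrite normalized_derive_inv.
(* [Psi (k t)] stays parallel to [v] and has velocity [d] at [t = 0]. *)
have dv i j : wedge d v i j = 0.
  have D : is_derive (0 : R) (1 : R)
     (v 0 j \*: (f i \o k) - v 0 i \*: (f j \o k)) (v 0 j *: d 0 i - v 0 i *: d 0 j).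
    by apply: is_deriveB; apply: is_deriveZ.
  have [_] := D; rewrite (@near_eq_derive _ _ _ _ (cst 0)) => [|].
    by rewrite derive_cst /wedge => E; rewrite -[RHS](esym E) /GRing.scale/=; ring.
  near=> t; have [|c Ec] := Lk t; first by near: t.
  rewrite /f/= -[LHS]/(v 0 j * Psi (k t) 0 i - v 0 i * Psi (k t) 0 j) Ec !mxE /cst.
  by ring.
have [c dE] := wedge_eq0 vn0 dv.
have cn0 : c != 0 by apply: contra dn0; rewrite dE => /eqP ->; rewrite scale0r.
have [j0 dj0] : exists j, d 0 j != 0.
  apply/existsP; rewrite -negb_forall; apply: contra dn0 => /forallP H0.
  by apply/eqP/rowP => i; rewrite mxE; exact/eqP.
(* A nonzero coordinate of [d] reads off the parameter in [Psi (k t) = h t *: d]; the normalization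
   gives [h] derivative 1 at 0. *)
pose h : R -> R := (d 0 j0)^-1 \*: (f j0 \o k).
have hE t : W (k t) -> Psi (k t) = h t *: d.
  move=> Wt; have [c' Ec'] := Lk t Wt.
  have vj0 : v 0 j0 != 0 by move: dj0; rewrite dE mxE mulf_eq0 negb_or => /andP[].
  rewrite /h -[X in X *: d]/((d 0 j0)^-1 * Psi (k t) 0 j0) Ec' dE scalerA; congr (_ *: _).
  by rewrite !mxE; field; rewrite cn0 vj0.
have h0 : h 0 = 0 by rewrite /h -[LHS]/((d 0 j0)^-1 * Psi (k 0) 0 j0) k0 Psi0 mxE mulr0.
have dh : is_derive (0 : R) (1 : R) h 1.
  apply: (@is_derive_eq _ _ _ _ _ _ _ _ (is_deriveZ (d 0 j0)^-1 (dg0 j0))).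
  by rewrite /GRing.scale/= mulVf.
have ch : \forall t \near (0 : R), {for t, continuous h}.
  near=> t; have Wt : W (k t) by near: t.
  have cf := continuous_comp (@kc t) (smoothR_continuous (sf j0) (WO _ Wt)).
  exact (@cvgMl_tmp _ _ _ _ (f j0 \o k) (d 0 j0)^-1 _ cf).
have := germ_surjective h0 dh ch kW; apply: filterS => s [t [Wt hts]].
by rewrite -hts -hE// PhiPsi//; exact: WO.
Unshelve. all: by end_near. Qed.

End Rectifier.

(** * Derivatives of the circle equation up to order four *)

Section Jets.
Context {R : realType} {n : nat}.
Local Notation V := 'rV[R]_n.
Implicit Types (x y : R -> V) (d : V) (t : R).

Lemma is_derive_wedge x (x' : V) d t j k :
  (forall k, is_derive t (1 : R) (fun s => x s 0 k) (x' 0 k)) ->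
  is_derive t (1 : R) (fun s => wedge (x s) d j k) (wedge x' d j k).
Proof.
move=> H.
have -> : (fun s => wedge (x s) d j k) =
    d 0 k \*: (fun s => x s 0 j) - d 0 j \*: (fun s => x s 0 k).
  apply/funext => s; rewrite -[RHS]/(d 0 k * x s 0 j - d 0 j * x s 0 k) /wedge.
  by ring.
have -> : wedge x' d j k = d 0 k *: x' 0 j - d 0 j *: x' 0 k.
  by rewrite /wedge /GRing.scale/=; ring.
by apply: is_deriveB; apply: is_deriveZ.
Qed.

Lemma is_derive_dot x y (x' y' : V) t :
  (forall k, is_derive t (1 : R) (fun s => x s 0 k) (x' 0 k)) ->
  (forall k, is_derive t (1 : R) (fun s => y s 0 k) (y' 0 k)) ->
  is_derive t (1 : R) (fun s => dotR (x s) (y s)) (dotR x' (y t) + dotR (x t) y').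
Proof.
move=> Hx Hy; rewrite /dotR -big_split/=.
elim: (index_enum 'I_n) => [|i s IHs].
  have -> : (fun s => \sum_(i <- [::]) x s 0 i * y s 0 i) = cst 0.
    by apply/funext => z; rewrite big_nil.
  by rewrite big_nil; exact: is_derive_cst.
have -> : (fun z => \sum_(i <- i :: s) x z 0 i * y z 0 i) =
    (fun s => x s 0 i) * (fun s => y s 0 i) + (fun z => \sum_(i <- s) x z 0 i * y z 0 i).
  by apply/funext => z; rewrite big_cons.
rewrite big_cons; apply: is_deriveD.
have -> : x' 0 i * y t 0 i + x t 0 i * y' 0 i = x t 0 i *: y' 0 i + y t 0 i *: x' 0 i.
  by rewrite /GRing.scale/=; ring.
exact: is_deriveM.
Qed.

Variables (U : set V) (Phi : V -> V) (d : V) (N : V).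
Hypotheses (oU : open U) (U0 : U 0) (sPhi : smooth_on U Phi) (Phi0 : Phi 0 = 0).
Hypothesis dPhi : 'D_d Phi 0 = d.
Hypothesis dn0 : d != 0.
Hypothesis circ : \forall t \near (0 : R), osc_circle d N (Phi (t *: d)).

(** The [m]-th derivative of [t |-> Phi (t d)], written with [dern] so that at [t = 0] it is known
    to be polynomial in [d]. *)
Definition jet m t : V := \row_k dern m d (fun z => Phi z 0 k) (t *: d).

Let nU : \forall t \near (0 : R), U (t *: d).
Proof.
have c : continuous (fun t : R => t *: d) by exact: scalel_continuous.
by apply: c; rewrite scale0r; exact: near_open.
Qed.

Let jet_derive t m k : U (t *: d) ->
  is_derive t (1 : R) (fun s => jet m s 0 k) (jet m.+1 t 0 k).
Proof.
move=> Ut; have sk := smoothR_dern d m oU (smooth_on_coord k oU sPhi).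
have -> : (fun s => jet m s 0 k) = (fun s => dern m d (fun z => Phi z 0 k) (s *: d)).
  by apply/funext => s; rewrite mxE.
by rewrite mxE; exact (is_derive_ray oU sk Ut).
Qed.

Let jet00 : jet 0 0 = 0.
Proof. by apply/rowP => k; rewrite !mxE /dern/= scale0r Phi0 mxE. Qed.

Let jet10 : jet 1 0 = d.
Proof.
apply/rowP => k; rewrite mxE /dern/= scale0r -row_derive ?dPhi//.
exact (@diff_derivable _ _ _ Phi 0 d (smooth_on_differentiable oU sPhi U0)).
Qed.

Let jet20 : jet 2 0 = 2 *: qmapR (quad_part Phi) d.
Proof.
by apply/rowP => k; rewrite mxE scale0r (dern2_quad_part _ _ oU sPhi U0) [RHS]mxE.
Qed.

Section Orders.
Variables j k : 'I_n.
Let om := wedge N d j k.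
Let c := dotR d d.
Let W m t := wedge (jet m t) d j k.
Let D a b t := dotR (jet a t) (jet b t).

Let dD t a b : U (t *: d) ->
  is_derive t (1 : R) (D a b) (D a.+1 b t + D a b.+1 t).
Proof. by move=> Ut; apply: is_derive_dot => i; exact: jet_derive. Qed.

Let f0 : \forall t \near (0 : R), c * W 0 t - om * D 0 0 t = 0.
Proof.
near=> t; have Ct : osc_circle d N (Phi (t *: d)) by near: t.
have JE : jet 0 t = Phi (t *: d) by apply/rowP => i; rewrite mxE.
by rewrite /W /D /c /om JE ((osc_circleP _ _ dn0).1 Ct j k) mulrC subrr.
Unshelve. all: by end_near. Qed.

Let step m (E E' : R -> R) : (\forall t \near (0 : R), c * W m t - om * E t = 0) ->
  (forall t, U (t *: d) -> is_derive t (1 : R) E (E' t)) ->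
  \forall t \near (0 : R), c * W m.+1 t - om * E' t = 0.
Proof.
move=> H dE; apply: (near0_derive H); near=> t.
have Ut : U (t *: d) by near: t.
have WD : is_derive t (1 : R) (W m) (W m.+1 t).
  by apply: is_derive_wedge => i; exact: jet_derive.
exact (is_deriveB (is_deriveZ c WD) (is_deriveZ om (dE t Ut))).
Unshelve. all: by end_near. Qed.

Let f1 : \forall t \near (0 : R), c * W 1 t - om * (D 1 0 t + D 0 1 t) = 0.
Proof. by apply: (step f0) => t Ut; exact: dD. Qed.

Let f2 : \forall t \near (0 : R), c * W 2 t - om *
  ((D 2 0 t + D 1 1 t) + (D 1 1 t + D 0 2 t)) = 0.
Proof.
by apply: (step f1) => t Ut; exact (is_deriveD (dD 1 0 Ut) (dD 0 1 Ut)).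
Qed.

Let f3 : \forall t \near (0 : R), c * W 3 t - om *
  (((D 3 0 t + D 2 1 t) + (D 2 1 t + D 1 2 t)) +
   ((D 2 1 t + D 1 2 t) + (D 1 2 t + D 0 3 t))) = 0.
Proof.
apply: (step f2) => t Ut; have H a b := dD a b Ut.
exact (is_deriveD (is_deriveD (H 2 0) (H 1 1)) (is_deriveD (H 1 1) (H 0 2))).
Qed.

(** The sixteen terms keep the shape in which the product rule delivers them; grouped, they have the
    binomial coefficients 1, 4, 6, 4, 1. *)
Let f4 : \forall t \near (0 : R), c * W 4 t - om *
  ((((D 4 0 t + D 3 1 t) + (D 3 1 t + D 2 2 t)) +
    ((D 3 1 t + D 2 2 t) + (D 2 2 t + D 1 3 t))) +
   (((D 3 1 t + D 2 2 t) + (D 2 2 t + D 1 3 t)) +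
    ((D 2 2 t + D 1 3 t) + (D 1 3 t + D 0 4 t)))) = 0.
Proof.
apply: (step f3) => t Ut; have H a b := dD a b Ut.
exact (is_deriveD
  (is_deriveD (is_deriveD (H 3 0) (H 2 1)) (is_deriveD (H 2 1) (H 1 2)))
  (is_deriveD (is_deriveD (H 2 1) (H 1 2)) (is_deriveD (H 1 2) (H 0 3)))).
Qed.

Let cn0 : c != 0. Proof. exact: lt0r_neq0 (dotR_gt0 dn0). Qed.
Let DC a b t : D a b t = D b a t. Proof. exact: dotRC. Qed.
Let D0 a : D 0 a 0 = 0. Proof. by rewrite /D jet00 dot0R. Qed.
Let D0' a : D a 0 0 = 0. Proof. by rewrite DC D0. Qed.
Let D12 : D 1 2 0 = 2 * dotR d (qmapR (quad_part Phi) d).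
Proof. by rewrite /D jet10 jet20 dotRZr. Qed.
Let D22 : D 2 2 0 = 4 * dotR (qmapR (quad_part Phi) d) (qmapR (quad_part Phi) d).
Proof. by rewrite /D jet20 dotRZr dotRZl mulrA; congr (_ * _); ring. Qed.

(** At [t = 0] the second derivative of [|Phi (t d)|^2] is [2 |d|^2] and that of [Phi (t d)] is
    [2 Phi_2(d)]; the factor [2 |d|^2] cancels. *)
Lemma jet_order2 : wedge N d j k = wedge (qmapR (quad_part Phi) d) d j k.
Proof.
have wZ a (u : V) : wedge (a *: u) d j k = a * wedge u d j k.
  by rewrite /wedge !mxE; ring.
have := nbhs_singleton f2; rewrite D0 D0' /D /W jet10 jet20 wZ => H.
by apply: (mulfI cn0); rewrite -/om; rewrite /c in H *; lra.
Qed.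

(** The coefficient 12 is six products of first and second derivatives, each equal to
    [2 (d, Phi_2(d))]. *)
Lemma jet_order3 : dotR d d * wedge (jet 3 0) d j k =
  12 * dotR d (qmapR (quad_part Phi) d) * wedge (qmapR (quad_part Phi) d) d j k.
Proof.
have := nbhs_singleton f3; rewrite D0 D0' (DC 2 1) D12 -jet_order2 -/om -/(W 3 0) => H.
by rewrite /c in H; lra.
Qed.

(** The coefficient 24 is six squares of the second derivative [2 Phi_2(d)]; the 8 counts the
    products of the first derivative [d] with the third. *)
Lemma jet_order4 : dotR d d * wedge (jet 4 0) d j k =
  (24 * dotR (qmapR (quad_part Phi) d) (qmapR (quad_part Phi) d) +
   8 * dotR d (jet 3 0)) * wedge (qmapR (quad_part Phi) d) d j k.
Proof.
have := nbhs_singleton f4; rewrite D0 D0' (DC 3 1) D22 -jet_order2 -/om -/(W 4 0).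
by rewrite /D jet10 /c => H; lra.
Qed.

End Orders.

End Jets.

(** * The class of the quadratic part *)

Section Classes.
Context {R : realType} {n : nat}.
Local Notation V := 'rV[R]_n.
Implicit Types (S : set (set V)) (Q : quad_coeffs R n) (d v : V).

Lemma wedge_r0 (u : V) j k : wedge u 0 j k = 0.
Proof. by rewrite /wedge !mxE !mulr0 subrr. Qed.

Lemma qmap_real Q v : qmap Q (cplx v 0) = cplx (qmapR Q v) 0.
Proof.
by rewrite qmap_cplx qmapR0 subr0 qpolar0r.
Qed.

(** Turns the complex relation into a pointwise one on real vectors. For the converse, the
    difference is radial at every real [v], [radial_quadratic] makes the factor one linear form, and
    the identity extends to complex vectors. *)
Lemma eq_mod_WnP Q1 Q2 : eq_mod_Wn Q1 Q2 <->
  forall v j k, wedge (qmapR Q1 v) v j k = wedge (qmapR Q2 v) v j k.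
Proof.
split=> [[lam H] v|H].
  have E : qmapR Q1 v - qmapR Q2 v = linform lam v *: v.
    have := H (cplx v 0); rewrite !qmap_real => /rowP Hv; apply/rowP => k.
    have := Hv k; rewrite (eq_bigr (fun i => (lam i * v 0 i +i* 0)%C)); last first.
      by move=> i _; rewrite !mxE; apply/eqP; rewrite eq_complex/=; apply/andP;
        split; apply/eqP; ring.
    rewrite sum_complex big1_eq.
    move: (qmapR Q1 v) (qmapR Q2 v) => a b; rewrite !mxE => -[-> _].
    by rewrite /linform mul0r subr0.
  move=> j k; have /rowP Ej := E; have := Ej j; have := Ej k.
  rewrite /wedge; move: (qmapR Q1 v) (qmapR Q2 v) => a b; rewrite !mxE => Hk Hj.
  apply/eqP; rewrite -subr_eq0; apply/eqP.
  transitivity ((a 0 j - b 0 j) * v 0 k - (a 0 k - b 0 k) * v 0 j); first by ring.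
  by rewrite Hk Hj; ring.
pose Q : quad_coeffs R n := fun k i j => Q1 k i j - Q2 k i j.
have QE v : qmapR Q v = qmapR Q1 v - qmapR Q2 v.
  apply/rowP => k; rewrite !mxE -sumrB; apply: eq_bigr => i _.
  by rewrite -sumrB; apply: eq_bigr => j _; rewrite !mulrBl.
have [l Hl] : exists l, forall v, qmapR Q v = linform l v *: v.
  apply: radial_quadratic => v j k; rewrite QE.
  have := H v j k; rewrite /wedge.
  by move: (qmapR Q1 v) (qmapR Q2 v) => a b; rewrite !mxE => Hjk; lra.
exists l => z; apply/rowP => k; apply/eqP; rewrite -subr_eq0; apply/eqP.
rewrite [(qmap Q1 z - _) 0 k]mxE [(- qmap Q2 z) 0 k]mxE [(_ *: z) 0 k]mxE.
move: z; apply: complexified_eq0 (fun v =>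
  qmapR Q1 v 0 k - qmapR Q2 v 0 k - linform l v * v 0 k) _ _ _ => [|v].
  apply: complexifiedB; first by apply: complexifiedB; exact: complexified_qmap.
  apply: complexifiedM; last exact: complexified_coord.
  apply: complexified_sum => i; apply: complexifiedM (complexified_coord i).
  exact: complexified_cst.
have /rowP/(_ k) := Hl v; rewrite QE.
by move: (qmapR Q1 v) (qmapR Q2 v) => a b; rewrite !mxE => ->; rewrite subrr.
Qed.

Lemma eq_mod_Wn_sym Q1 Q2 : eq_mod_Wn Q1 Q2 -> eq_mod_Wn Q2 Q1.
Proof. by move=> /eq_mod_WnP H; apply/eq_mod_WnP => v j k; rewrite H. Qed.

Lemma bundle_circle S d : complete_bundle S -> d != 0 ->
  exists N, dotR d N = 0 /\ S (osc_circle d N).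
Proof.
move=> cS dn0; have [K [SK [tK _]]] := cS d dn0.
have [_ [N [dN KE]]] := tangent_osc_circle tK.
by exists N; rewrite -KE.
Qed.

Section Rectified.
Variables (S : set (set V)) (U : set V) (Phi Psi : V -> V).
Hypothesis cS : complete_bundle S.
Hypothesis nr : normalized_rectifier S U Phi Psi.

Let oU : open U := nr.1.1.
Let U0 : U 0 := nr.1.2.1.
Let Phi0 : Phi 0 = 0 := nr.1.2.2.1.
Let sPhi : smooth_on U Phi := nr.1.2.2.2.2.1.

Lemma rectifier_curvature d N j k : d != 0 -> dotR d N = 0 -> S (osc_circle d N) ->
  wedge N d j k = wedge (qmapR (quad_part Phi) d) d j k.
Proof.
move=> dn0 dN SK; apply: (@jet_order2 _ _ U Phi d N oU U0 sPhi Phi0) => //.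
  exact: normalized_derive nr d.
exact (rectifier_circle nr dn0 dN SK).
Qed.

(** Completeness provides a circle in every direction [v != 0], so the third- and fourth-order
    identities hold for all real [v], as [jets_in_Vn] requires. *)
Lemma rectifier_in_Vn : in_Vn (quad_part Phi).
Proof.
have cx m : exists h : 'rV[R[i]]_n -> 'rV[R[i]]_n, forall k,
    complexified (fun v => jet Phi v m 0 0 k) (fun z => h z 0 k).
  have H k := complexified_dern m oU (smooth_on_coord k oU sPhi) U0.
  pose g k := sval (cid (H k)).
  exists (fun z => \row_k g k z) => k.
  rewrite (_ : (fun v => _) = (fun v => dern m v (fun x => Phi x 0 k) 0)); last first.
    by apply/funext => v; rewrite mxE scale0r.
  rewrite (_ : (fun z => _) = g k); last by apply/funext => z; rewrite mxE.
  exact: svalP (cid (H k)).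
have [h3 H3] := cx 3%N; have [h4 H4] := cx 4%N.
apply: (jets_in_Vn H3 H4) => v j k; have [->|vn0] := eqVneq v 0.
- by rewrite dot0R mul0r wedge_r0 mulr0.
- have [N [dN SN]] := bundle_circle cS vn0.
  apply: (@jet_order3 _ _ U Phi v N oU U0 sPhi Phi0) => //.
    exact: normalized_derive nr v.
  exact (rectifier_circle nr vn0 dN SN).
- by rewrite dot0R mul0r wedge_r0 mulr0.
- have [N [dN SN]] := bundle_circle cS vn0.
  apply: (@jet_order4 _ _ U Phi v N oU U0 sPhi Phi0) => //.
    exact: normalized_derive nr v.
  exact (rectifier_circle nr vn0 dN SN).
Qed.

End Rectified.

Lemma rectifier_class S U1 Phi1 Psi1 U2 Phi2 Psi2 : complete_bundle S ->
  normalized_rectifier S U1 Phi1 Psi1 -> normalized_rectifier S U2 Phi2 Psi2 ->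
  eq_mod_Wn (quad_part Phi1) (quad_part Phi2).
Proof.
move=> cS nr1 nr2; apply/eq_mod_WnP.
move: (rectifier_curvature nr1) (rectifier_curvature nr2).
move: (quad_part Phi1) (quad_part Phi2) => Q1 Q2 H1 H2 v j k.
have [->|vn0] := eqVneq v 0; first by rewrite !wedge_r0.
have [N [dN SN]] := bundle_circle cS vn0.
by rewrite -(H1 _ _ j k vn0 dN SN) (H2 _ _ j k vn0 dN SN).
Qed.

(** A circle of [S1] and the circle of [S2] with the same tangent [d] have vectors [N] equal modulo
    [d] to the two quadratic parts at [d], which agree modulo [d]. *)
Lemma bundle_sub S1 S2 U1 Phi1 Psi1 U2 Phi2 Psi2 :
  simple_bundle S1 -> complete_bundle S2 ->
  normalized_rectifier S1 U1 Phi1 Psi1 -> normalized_rectifier S2 U2 Phi2 Psi2 ->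
  eq_mod_Wn (quad_part Phi1) (quad_part Phi2) -> S1 `<=` S2.
Proof.
move=> sS1 cS2 nr1 nr2.
move: (rectifier_curvature nr1) (rectifier_curvature nr2).
move: (quad_part Phi1) (quad_part Phi2) => Q1 Q2 H1 H2 /eq_mod_WnP Q12 K S1K.
have [cK K0] := sS1.1 _ S1K; have [d tK] := circle_has_tangent cK K0.
have [dn0 [N [dN KE]]] := tangent_osc_circle tK.
have [N' [dN' S2N']] := bundle_circle cS2 dn0.
rewrite KE in S1K *; rewrite (@osc_circle_eq _ _ d N N')// => j k.
by rewrite (H1 _ _ j k dn0 dN S1K) Q12 -(H2 _ _ j k dn0 dN' S2N').
Qed.

End Classes.

(** * Normalising a rectifying germ *)

Section Normalization.
Context {R : realType} {n : nat}.
Local Notation V := 'rV[R]_n.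

Definition jacobian0 (F : V -> V) : 'M[R]_n := \matrix_(i, j) ('D_(e_ R i) F 0) 0 j.

Lemma jacobian0E U (F : V -> V) v : open U -> smooth_on U F -> U 0 ->
  'D_v F 0 = v *m jacobian0 F.
Proof.
move=> oU sF U0; rewrite (smooth_on_derive _ oU sF U0).
apply/rowP => j; rewrite [RHS]mxE summxE; apply: eq_bigr => i _.
by rewrite [LHS]mxE [jacobian0 _ _ _]mxE.
Qed.

Lemma diffeo_jacobianK U F G : @diffeo_germ0 R n U F G ->
  jacobian0 F *m jacobian0 G = 1%:M.
Proof.
move=> FG; have [oU [U0 [_ [oO [sF [sG _]]]]]] := FG.
apply/row_matrixP => i; rewrite !rowE mulmx1 mulmxA.
rewrite -(jacobian0E _ oU sF U0) -(jacobian0E _ oO sG (diffeo_im0 FG)).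
exact: diffeo_deriveK FG _.
Qed.

(** [F] goes from circles to lines, so [Phi] is built from its inverse [G]. Precomposing with the
    differential [A] of [F] makes the derivative at 0 the identity, and linear isomorphisms keep
    lines straight. *)
Lemma normalized_rectifier_ex (S : set (set V)) : rectifiable S ->
  exists U Phi Psi, normalized_rectifier S U Phi Psi.
Proof.
move=> [U [F [G [FG lines]]]].
have [oU [U0 [F0 [oO [sF [sG [GF FGy]]]]]]] := FG.
pose A := jacobian0 F; pose B := jacobian0 G.
have AB : A *m B = 1%:M := diffeo_jacobianK FG.
have BA : B *m A = 1%:M by apply: diffeo_jacobianK (diffeo_germ_inv FG).
have AK (v : V) : v *m A *m B = v by rewrite -mulmxA AB mulmx1.
have BK (v : V) : v *m B *m A = v by rewrite -mulmxA BA mulmx1.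
pose O := F @` U; pose U' : set V := [set x | O (x *m A)].
pose Phi (x : V) := G (x *m A); pose Psi (y : V) := F y *m B.
have oU' : open U' by have /continuousP := @mulmxr_continuous R n A; apply.
have imPhi : Phi @` U' = U.
  apply/seteqP; split=> x /=.
    by move=> [y [z Uz zy] <-]; rewrite /Phi -zy GF.
  by move=> Ux; exists (F x *m B); rewrite /U' /Phi /= ?BK ?GF//; exists x.
have U'0 : U' 0 by exists 0; rewrite // mul0mx.
have Phi0 : Phi 0 = 0 by rewrite /Phi mul0mx (diffeo_inv0 FG).
have sPhi : smooth_on U' Phi.
  apply: (coord_smooth_on oU') => j k.
  exact: (@Ck_linear _ _ k O A (fun x => G x 0 j) oO (smooth_on_coord j oO sG k)).
have sPsi : smooth_on U Psi.
  apply: (coord_smooth_on oU) => j k.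
  apply: (@Ck_ext _ _ _ _ (fun y => \sum_i F y 0 i * B i j)) => //.
    by move=> x Ux; rewrite mxE.
  apply: Ck_sum => // i; apply: CkM => //; last exact: Ck_cst.
  exact: smooth_on_coord.
have PsiPhi x : U' x -> Psi (Phi x) = x.
  by move=> [z Uz zx]; rewrite /Psi /Phi -zx (GF _ Uz) zx; exact: AK.
have PhiPsi y : U y -> Phi (Psi y) = y.
  by move=> Uy; rewrite /Psi /Phi BK (GF _ Uy).
exists U', Phi, Psi; split.
  rewrite /diffeo_germ0 imPhi.
  exact (conj oU' (conj U'0 (conj Phi0 (conj oU (conj sPhi (conj sPsi
    (conj PsiPhi PhiPsi))))))).
split=> [j|K /lines [W [oW [W0 [WU [L [[a [v [vn0 LE]]] KL]]]]]]].
  have -> : 'D_(e_ R j) Phi 0 = 'D_(e_ R j *m A) G (0 *m A).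
    have E : (fun h : R => h^-1 *: ((Phi \o shift 0) (h *: e_ R j) - Phi 0)) =
        (fun h => h^-1 *: ((G \o shift (0 *m A)) (h *: (e_ R j *m A)) - G (0 *m A))).
      by apply/funext => h; rewrite /Phi /= mulmxDl scalemxAl.
    by rewrite /derive E.
  by rewrite mul0mx (jacobian0E _ oO sG (diffeo_im0 FG)) AK.
exists W; split=> //; split=> //; split; first by rewrite imPhi.
exists [set a *m B + t *: (v *m B) | t in [set: R]]; split.
  exists (a *m B), (v *m B); split=> //; apply: contra vn0 => /eqP vB.
  by rewrite -(BK v) vB mul0mx.
move=> _ [x KWx <-]; have : L (F x) by apply: KL; exists x.
by rewrite LE => -[t _ tE]; exists t => //; rewrite /Psi -tE mulmxDl scalemxAl.
Qed.

End Normalization.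

(** * The bundle of a given class *)

Section SmoothMatrix.
Context {R : realType} {n : nat}.
Local Notation V := 'rV[R]_n.
Implicit Types (U : set V) (k : nat) (M : 'I_n -> 'I_n -> R) (u v w : V).

Lemma Ck_det k U m (A : V -> 'M[R]_m) : open U ->
  (forall i j, Ck k U (fun x => A x i j)) -> Ck k U (fun x => \det (A x)).
Proof.
move=> oU cA; rewrite /determinant; apply: Ck_sum => // s.
by apply: CkM => //; [exact: Ck_cst|exact: Ck_prod].
Qed.

Lemma Ck_adj k U m (A : V -> 'M[R]_m) i j : open U ->
  (forall i j, Ck k U (fun x => A x i j)) -> Ck k U (fun x => \adj (A x) i j).
Proof.
move=> oU cA; apply: (@Ck_ext _ _ _ _
  (fun x => (-1) ^+ (j + i) * \det (row' j (col' i (A x))))) => //.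
  by move=> x _; rewrite mxE.
apply: CkM => //; first exact: Ck_cst.
apply: Ck_det => // a b; apply: Ck_ext (cA (lift j a) (lift i b)) => // x _.
by rewrite !mxE.
Qed.

Lemma Ck_qform k U M : open U -> Ck k U (qform M).
Proof.
move=> oU; apply: Ck_sum => // i; apply: Ck_sum => // j.
by apply: CkM (Ck_coord _ _ _) => //; apply: CkM (Ck_coord _ _ _) => //; exact: Ck_cst.
Qed.

Lemma Ck_qmapR k U (Q : quad_coeffs R n) j : open U ->
  Ck k U (fun x => qmapR Q x 0 j).
Proof.
move=> oU; apply: Ck_ext (@Ck_qform k U (Q j) oU) => // x _.
by rewrite mxE.
Qed.

Lemma Ck_dotR k U (F G : V -> V) : open U -> (forall j, Ck k U (fun x => F x 0 j)) ->
  (forall j, Ck k U (fun x => G x 0 j)) -> Ck k U (fun x => dotR (F x) (G x)).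
Proof. by move=> oU cF cG; apply: Ck_sum => // i; exact: CkM. Qed.

Definition qform_polar (M : 'I_n -> 'I_n -> R) (u w : V) : R :=
  \sum_i \sum_j M i j * (u 0 i * w 0 j + w 0 i * u 0 j).

Lemma qformD M u s w :
  qform M (u + s *: w) = qform M u + s * qform_polar M u w + s ^+ 2 * qform M w.
Proof.
rewrite /qform /qform_polar !mulr_sumr -!big_split; apply: eq_bigr => i _.
rewrite !mulr_sumr -!big_split; apply: eq_bigr => j _ /=.
by rewrite !mxE; ring.
Qed.

Lemma qformZ M s w : qform M (s *: w) = s ^+ 2 * qform M w.
Proof.
rewrite /qform mulr_sumr; apply: eq_bigr => i _; rewrite mulr_sumr.
by apply: eq_bigr => j _ /=; rewrite !mxE; ring.
Qed.

Lemma qform_polarDr M u v w a :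
  qform_polar M u (a *: v + w) = a * qform_polar M u v + qform_polar M u w.
Proof.
rewrite /qform_polar !mulr_sumr -!big_split; apply: eq_bigr => i _.
by rewrite !mulr_sumr -!big_split; apply: eq_bigr => j _ /=; rewrite !mxE; ring.
Qed.

Lemma qform_polarC M u v : qform_polar M u v = qform_polar M v u.
Proof.
by apply: eq_bigr => i _; apply: eq_bigr => j _; rewrite [X in _ * X]addrC.
Qed.

Lemma qform_polar0 M u : qform_polar M 0 u = 0.
Proof.
by rewrite /qform_polar big1// => i _; rewrite big1// => j _; rewrite !mxE; ring.
Qed.

(** At [s = - a / (|b| + 1)] the linear term outweighs the quadratic one, so a nonzero [a] would
    give a negative value. *)
Lemma linear_coef_eq0 (a b : R) : (forall s, 0 <= s * a + s ^+ 2 * b) -> a = 0.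
Proof.
move=> H; apply/eqP/negPn/negP => a0.
have b0 : 0 < `|b| + 1 by rewrite ltr_wpDl.
have := H (- a / (`|b| + 1)).
have -> : - a / (`|b| + 1) * a + (- a / (`|b| + 1)) ^+ 2 * b =
   (a ^+ 2 / (`|b| + 1) ^+ 2) * (b - `|b| - 1).
  by field; rewrite lt0r_neq0.
rewrite pmulr_rge0; last by apply: divr_gt0; [rewrite exprn_even_gt0|exact: exprn_gt0].
by have := ler_norm b; lra.
Qed.

End SmoothMatrix.

(** * The rational rectifier and its inverse *)

Section Construction.
Context {R : realType} {n : nat}.
Local Notation V := 'rV[R]_n.
Implicit Types (u v w x y d : V).
Variables (Q : quad_coeffs R n) (M : 'I_n -> 'I_n -> R).
Local Notation Gam := (qmapR Q).
Local Notation P := (qpolar Q).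
Local Notation q := (qform M).
Local Notation qp := (qform_polar M).
Hypothesis dotG : forall v, dotR v (Gam v) = 0.
Hypothesis normG : forall v, dotR (Gam v) (Gam v) = dotR v v * q v.

Lemma q_ge0 v : 0 <= q v.
Proof.
have [->|vn0] := eqVneq v 0; first by have := qformZ M 0 0; rewrite scaler0 expr0n mul0r => ->.
by rewrite -(pmulr_rge0 _ (dotR_gt0 vn0)) -normG dotR_ge0.
Qed.

Lemma q1_gt0 v : 0 < 1 + q v.
Proof. by rewrite ltr_pwDl// q_ge0. Qed.

Let q1n0 v : 1 + q v != 0. Proof. exact: lt0r_neq0 (q1_gt0 v). Qed.

Definition rect v : V := (1 + q v)^-1 *: (v + Gam v).

(** [normG] turns [|Gam d|^2 / |d|^2] into [q d], so the denominators agree: along a ray, [rect] is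
    the rational parametrisation of a circle. *)
Lemma rect_osc_point d t : d != 0 -> rect (t *: d) = osc_point d (Gam d) t.
Proof.
move=> dn0; have dd := lt0r_neq0 (dotR_gt0 dn0).
by rewrite /rect /osc_point qformZ qmapRZ normG [dotR d d * _]mulrC mulfK.
Qed.

Lemma rect_scale v : (1 + q v) *: rect v = v + Gam v.
Proof. by rewrite scalerA mulfV// scale1r. Qed.

Lemma rect_dot v : (1 + q v) * dotR (rect v) (rect v) = dotR v v.
Proof.
have E : dotR (v + Gam v) (v + Gam v) = (1 + q v) * dotR v v.
  by rewrite !dotE (dotRC (Gam v)) dotG normG; ring.
by apply: (mulfI (q1n0 v)); rewrite -E -(rect_scale v) dotRZl dotRZr mulrA.
Qed.

Lemma rect0 : rect 0 = 0.
Proof. by rewrite /rect qmapR0 addr0 scaler0. Qed.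

(* For fixed [x] the quadratic function
   [|w|^2 + (1 + q w) |x|^2 - 2 (x, w + Gam w) = (1 + q w) |x - rect w|^2]
   is nonnegative and vanishes where [rect w = x], so its gradient vanishes
   there: [rect w = x] implies a system that is linear in [w]. *)
Definition grad x v w := dotR v w + dotR x x / 2 * qp v w - dotR x w - dotR x (P v w).

Lemma grad_rect v w : grad (rect v) v w = 0.
Proof.
set x := rect v.
pose h w' := dotR w' w' + (1 + q w') * dotR x x - 2 * dotR x (w' + Gam w').
have h_ge0 w' : 0 <= h w'.
  have -> : h w' = (1 + q w') * dotR (x - rect w') (x - rect w').
    rewrite /h -(rect_scale w') -(rect_dot w'); move: (x) (rect w') => a b.
    by rewrite !dotE (dotRC b a); ring.
  by rewrite mulr_ge0 ?dotR_ge0 ?(ltW (q1_gt0 _)).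
have hv : h v = 0.
  rewrite /h -(rect_scale v) -(rect_dot v) -/x; move: (x) => a.
  by rewrite dotRZr; ring.
apply: (mulfI (_ : 2 != 0)); first by rewrite pnatr_eq0.
rewrite mulr0; apply: (linear_coef_eq0 (b := dotR w w + q w * dotR x x - 2 * dotR x (Gam w))).
move=> s; have := h_ge0 (v + s *: w).
suff -> : h (v + s *: w) = h v + s * (2 * grad x v w) +
    s ^+ 2 * (dotR w w + q w * dotR x x - 2 * dotR x (Gam w)) by rewrite hv add0r.
have := qmapR_comb Q 1 s v w; rewrite scale1r expr1n mul1r scale1r => GE.
rewrite /h /grad GE qformD; move: (x) => a.
by rewrite !dotE (dotRC w v); field.
Qed.

(** [grad x v w] is affine in [v] and equals [(v *m grad_mx x - x, w)]; it vanishes for all [w]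
    exactly when [v *m grad_mx x = x]. *)
Definition grad_mx x : 'M[R]_n := \matrix_(i, j)
  ((i == j)%:R + dotR x x / 2 * qp (e_ R i) (e_ R j) - dotR x (P (e_ R i) (e_ R j))).

Lemma grad_mxE x v j : (v *m grad_mx x) 0 j = grad x v (e_ R j) + x 0 j.
Proof.
have vE : v = \sum_i v 0 i *: e_ R i := row_sum_e v.
have qE : qp v (e_ R j) = \sum_i v 0 i * qp (e_ R i) (e_ R j).
  rewrite qform_polarC {1}vE; elim/big_rec2: _ => [|i a b _ <-].
    by rewrite qform_polarC qform_polar0.
  by rewrite qform_polarDr (qform_polarC _ (e_ R j)).
have pE : P v (e_ R j) = \sum_i v 0 i *: P (e_ R i) (e_ R j).
  rewrite qpolarC {1}vE qpolar_sumr; apply: eq_bigr => i _.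
  by rewrite qpolarZr qpolarC.
rewrite /grad mxE qE pE dotR_sumr (dotRC v) (dotRC x (e_ R j)) !dotR_e.
rewrite mulr_sumr {1}(_ : v 0 j = \sum_i v 0 i * (i == j)%:R); last first.
  by rewrite (bigD1 j)//= eqxx mulr1 big1 ?addr0// => i /negbTE ->; rewrite mulr0.
rewrite -big_split/= addrAC subrK -sumrB; apply: eq_bigr => i _.
by rewrite mxE dotRZr; ring.
Qed.

(** Cramer's solution of [v *m grad_mx x = x]; determinant and adjugate display it as a rational
    function of [x]. *)
Definition unrect x : V := (\det (grad_mx x))^-1 *: (x *m \adj (grad_mx x)).

Lemma unrect0 : unrect 0 = 0.
Proof. by rewrite /unrect mul0mx scaler0. Qed.

Lemma grad_mx_rect v : v *m grad_mx (rect v) = rect v.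
Proof. by apply/rowP => j; rewrite grad_mxE grad_rect add0r. Qed.

Lemma rectK v : \det (grad_mx (rect v)) != 0 -> unrect (rect v) = v.
Proof.
move=> D; rewrite /unrect -{2}grad_mx_rect -mulmxA mul_mx_adj mul_mx_scalar.
by rewrite scalerA mulVf// scale1r.
Qed.

Lemma unrect_grad x w : \det (grad_mx x) != 0 -> grad x (unrect x) w = 0.
Proof.
move=> D; have E j : grad x (unrect x) (e_ R j) = 0.
  apply: (@addIr _ (x 0 j)); rewrite -grad_mxE /unrect -scalemxAl -mulmxA.
  by rewrite mul_adj_mx mul_mx_scalar scalerA mulVf// scale1r add0r.
move: (unrect x) E => u E; rewrite (row_sum_e w).
elim/big_ind: _ => [|a b Ha Hb|i _].
- by rewrite /grad !dotR0 qform_polarC qform_polar0 qpolar0r dotR0; ring.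
- have qD : qp u (a + b) = qp u a + qp u b.
    by have := qform_polarDr M u a b 1; rewrite scale1r mul1r.
  transitivity (grad x u a + grad x u b); last by rewrite Ha Hb addr0.
  by rewrite /grad qpolarDr qD !dotE; ring.
- have qZ : qp u (w 0 i *: e_ R i) = w 0 i * qp u (e_ R i).
    rewrite -[w 0 i *: _]addr0 qform_polarDr [qp _ 0]qform_polarC qform_polar0.
    by rewrite addr0.
  transitivity (w 0 i * grad x u (e_ R i)); last by rewrite E mulr0.
  by rewrite /grad qpolarZr qZ !dotE; ring.
Qed.

(* Subtracting the linear systems of [x] and of [rect (unrect x)] gives a linear
   equation for the defect [x - rect (unrect x)] with this matrix. *)
Definition defect_mx x : 'M[R]_n := let v := unrect x in \matrix_(i, j)
  ((i == j)%:R - (x 0 i + rect v 0 i) / 2 * qp v (e_ R j) + P v (e_ R j) 0 i).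

(** The linear system is only a necessary condition for [rect v = x], so its solution [v] must be
    checked. It also solves the system of [y = rect v], and comparing the two forces [x = y]. *)
Lemma unrectK x : \det (grad_mx x) != 0 -> \det (defect_mx x) != 0 ->
  rect (unrect x) = x.
Proof.
move=> D1 D2; set v := unrect x; set y := rect v; pose e := x - y.
suff e0 : e = 0 by apply/eqP; rewrite eq_sym -subr_eq0; exact/eqP.
have E : e *m defect_mx x = 0.
  apply/rowP => j; rewrite [RHS]mxE.
  have E1 := unrect_grad (e_ R j) D1; have E2 := grad_rect v (e_ R j).
  rewrite -/v in E1; rewrite -/y in E2.
  (* Since [|x|^2 - |y|^2 = (e, x + y)], the difference of the two systems is linear in [e],
     although [grad] is quadratic in [x]. *)
  have -> : (e *m defect_mx x) 0 j = dotR e (e_ R j) - dotR e (x + y) / 2 * qp v (e_ R j)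
     + dotR e (P v (e_ R j)).
    rewrite (dotRC e (e_ R j)) dotR_e mxE {1}/dotR.
    rewrite {1}(_ : e 0 j = \sum_i e 0 i * (i == j)%:R); last first.
      by rewrite (bigD1 j)//= eqxx mulr1 big1 ?addr0// => i /negbTE ->; rewrite mulr0.
    rewrite -mulrA mulr_suml -sumrB -big_split/=; apply: eq_bigr => i _.
    by rewrite [defect_mx _ _ _]mxE -/v -/y [(x + y) 0 i]mxE; ring.
  transitivity (grad y v (e_ R j) - grad x v (e_ R j)); last by rewrite E1 E2 subrr.
  rewrite /grad /e; move: (x) (v) (y) => a b c.
  by rewrite !dotE (dotRC c a); field.
have uD : defect_mx x \in unitmx by rewrite unitmxE unitfE.
by rewrite -(mulmxK uD e) E mul0mx.
Qed.

End Construction.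

Section NonvanishingOpen.
Context {R : realType} {n : nat}.
Local Notation V := 'rV[R]_n.

Lemma Ck_neq0_open k (A : set V) (f : V -> R) : open A -> Ck k A f ->
  open [set x | A x /\ f x != 0].
Proof.
move=> oA cf; rewrite openE => x [Ax fx].
have cx := Ck_continuous cf Ax.
have nf : \forall y \near x, f y != 0 by exact (cvgr_neq0 _ cx fx).
near=> y; split; first by near: y; exact: near_open.
by near: y.
Unshelve. all: by end_near. Qed.

Lemma Ck0_comp (A : set V) (F : V -> V) (f : V -> R) :
  (forall j, Ck 0 A (fun x => F x 0 j)) -> Ck 0 setT f -> Ck 0 A (fun x => f (F x)).
Proof.
move=> cF cf; split=> // x Ax.
have cx : {for x, continuous F}.
  by apply: row_continuous => j; exact (Ck_continuous (cF j) Ax).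
exact (continuous_comp cx (Ck_continuous cf I)).
Qed.

End NonvanishingOpen.

(** * The circles that are images of lines under [rect] *)

Section Bundle.
Context {R : realType} {n : nat}.
Local Notation V := 'rV[R]_n.
Implicit Types (u v w x y d : V).
Variables (Q : quad_coeffs R n) (M : 'I_n -> 'I_n -> R).
Local Notation Gam := (qmapR Q).
Local Notation P := (qpolar Q).
Local Notation q := (qform M).
Local Notation qp := (qform_polar M).
Hypothesis dotG : forall v, dotR v (Gam v) = 0.
Hypothesis normG : forall v, dotR (Gam v) (Gam v) = dotR v v * q v.
Local Notation rect := (rect Q M).
Local Notation unrect := (unrect Q M).
Local Notation grad_mx := (grad_mx Q M).
Local Notation defect_mx := (defect_mx Q M).

Let oT : open [set: V] := openT.

Let crect k j : Ck k setT (fun x => rect x 0 j).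
Proof.
apply: (@Ck_ext _ _ _ _ (fun x => (1 + q x)^-1 * (x 0 j + Gam x 0 j))) => //.
  by move=> x _; rewrite [rect _ _ _]mxE [(x + _) 0 j]mxE.
apply: CkM => //; last by apply: CkD => //; [exact: Ck_coord|exact: Ck_qmapR].
apply: CkV => //; first by move=> x _; exact: lt0r_neq0 (q1_gt0 normG x).
by apply: CkD => //; [exact: Ck_cst|exact: Ck_qform].
Qed.

Let cgrad k i j : Ck k setT (fun x => grad_mx x i j).
Proof.
apply: (@Ck_ext _ _ _ _ (fun x => ((i == j)%:R + dotR x x * (2^-1 * qp (e_ R i) (e_ R j)))
  + (-1) * dotR x (P (e_ R i) (e_ R j)))) => //.
  by move=> x _; rewrite [RHS]mxE; ring.
apply: CkD => //; first (apply: CkD => //; first exact: Ck_cst).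
  apply: CkM (Ck_cst _ _ _) => //.
  by apply: Ck_dotR => // a; exact: Ck_coord.
apply: CkM => //; first exact: Ck_cst.
by apply: Ck_dotR => // a; [exact: Ck_coord|exact: Ck_cst].
Qed.

Let A1 : set V := [set x | \det (grad_mx x) != 0].

Let oA1 : open A1.
Proof.
have := @Ck_neq0_open R n 0 setT _ oT (Ck_det oT (cgrad 0)).
by rewrite (_ : [set x | setT x /\ _] = A1)//; apply/seteqP; split=> x /=; [case|].
Qed.

Let cunrect k j : Ck k A1 (fun x => unrect x 0 j).
Proof.
have cg a b : Ck k A1 (fun x => grad_mx x a b) := Ck_sub (@subsetT _ A1) (cgrad k a b).
apply: (@Ck_ext _ _ _ _ (fun x => (\det (grad_mx x))^-1 *
    \sum_i x 0 i * \adj (grad_mx x) i j)) => //.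
  by move=> x _; rewrite [unrect _ _ _]mxE [(x *m _) 0 j]mxE.
apply: CkM => //; first by apply: CkV => //; exact: Ck_det.
apply: Ck_sum => // i; apply: CkM => //; first exact: Ck_coord.
exact: Ck_adj.
Qed.

(** Level 0 suffices: [defect_mx] only serves to cut out the open set [O]. *)
Let cdefect i j : Ck 0 A1 (fun x => defect_mx x i j).
Proof.
have cc (f : V -> R) : Ck 0 setT f -> Ck 0 A1 (fun x => f (unrect x)).
  exact: Ck0_comp (cunrect 0).
apply: (@Ck_ext _ _ _ _ (fun x => ((i == j)%:R +
   (x 0 i + rect (unrect x) 0 i) * ((- 2^-1) * qp (unrect x) (e_ R j)))
   + P (unrect x) (e_ R j) 0 i)) => //.
  by move=> x _; rewrite [RHS]mxE; ring.
apply: CkD => //; first (apply: CkD => //; first exact: Ck_cst).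
  apply: CkM => //.
    apply: CkD => //; first exact: Ck_coord.
    exact: (cc (fun v => rect v 0 i)).
  apply: CkM => //; first exact: Ck_cst.
  apply: (cc (fun v => qp v (e_ R j))); apply: Ck_sum => // a; apply: Ck_sum => // b.
  apply: CkM => //; first exact: Ck_cst.
  by apply: CkD => //; apply: CkM => //; (exact: Ck_cst || exact: Ck_coord).
apply: (cc (fun v => P v (e_ R j) 0 i)).
apply: (@Ck_ext _ _ _ _ (fun v => \sum_a \sum_b Q i a b *
   (v 0 a * e_ R j 0 b + e_ R j 0 a * v 0 b))) => //.
  by move=> x _; rewrite [RHS]mxE.
apply: Ck_sum => // a; apply: Ck_sum => // b.
apply: CkM => //; first exact: Ck_cst.
by apply: CkD => //; apply: CkM => //; (exact: Ck_cst || exact: Ck_coord).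
Qed.

(** Both matrices are the identity at 0, so [O] is a neighbourhood of 0. There [unrect] is a right
    inverse of [rect], and on the preimage [U] a left inverse. *)
Let O : set V := [set x | A1 x /\ \det (defect_mx x) != 0].

Let oO : open O. Proof. exact: (Ck_neq0_open oA1 (Ck_det oA1 cdefect)). Qed.

Let O0 : O 0.
Proof.
have G0 : grad_mx 0 = 1%:M.
  by apply/matrixP => i j; rewrite !mxE !dot0R; ring.
have D0 : defect_mx 0 = 1%:M.
  apply/matrixP => i j; rewrite [LHS]mxE (unrect0 Q M) rect0 qform_polar0 qpolarC qpolar0r.
  by rewrite !mxE; ring.
rewrite /O /A1; split; first by change (\det (grad_mx 0) != 0); rewrite G0 det1 oner_eq0.
by change (\det (defect_mx 0) != 0); rewrite D0 det1 oner_eq0.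
Qed.

Let U : set V := [set v | O (rect v)].

Let imU : rect @` U = O.
Proof.
apply/seteqP; split=> x; first by move=> [v Ov <-].
move=> Ox; have xK : rect (unrect x) = x.
  by have [x1 x2] := Ox; exact (unrectK dotG normG x1 x2).
exact (ex_intro2 _ _ (unrect x) (eq_ind_r O Ox xK) xK).
Qed.

Let rc : continuous rect.
Proof. by move=> x; apply: row_continuous => j; exact (Ck_continuous (crect 0 j) I). Qed.

Let oU : open U. Proof. by have /continuousP := rc; apply. Qed.

Let U0 : U 0.
Proof. by have H := O0; rewrite -(rect0 Q M) in H; exact H. Qed.

Let sU : smooth_on U rect.
Proof. by apply: (coord_smooth_on oU) => j k; exact (Ck_sub (@subsetT _ U) (crect k j)). Qed.

Let sO : smooth_on O unrect.
Proof.
have OA : O `<=` A1 by move=> x [].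
by apply: (coord_smooth_on oO) => j k; exact (Ck_sub OA (cunrect k j)).
Qed.

Let UK x : U x -> unrect (rect x) = x.
Proof. by case=> Ox _; exact (rectK dotG normG Ox). Qed.

Let OK y : O y -> rect (unrect y) = y.
Proof. by case=> y1 y2; exact (unrectK dotG normG y1 y2). Qed.

Lemma rect_diffeo : diffeo_germ0 U rect unrect.
Proof.
rewrite /diffeo_germ0 imU.
exact (conj oU (conj U0 (conj (rect0 Q M) (conj oO (conj sU (conj sO (conj UK OK))))))).
Qed.

Lemma rect_derive d : 'D_d rect 0 = d.
Proof.
have [->|dn0] := eqVneq d 0; first exact: derive0.
have [_ E] := osc_point_derive d (Gam d).
rewrite -[RHS]E /derive.
have EE : (fun h : R => h^-1 *: ((rect \o shift 0) (h *: d) - rect 0)) =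
   (fun h : R => h^-1 *: ((osc_point d (Gam d) \o shift 0) (h *: (1 : R)) -
      osc_point d (Gam d) 0)).
  apply/funext => h; rewrite osc_point0 rect0 /= !addr0 [_%:A]mulr1.
  by rewrite (rect_osc_point normG).
by rewrite EE.
Qed.

Definition curved_bundle : set (set V) :=
  [set K | exists d, d != 0 /\ K = osc_circle d (Gam d)].

Lemma curved_bundle_tangent K d : curved_bundle K -> tangent_at0 K d ->
  K = osc_circle d (Gam d).
Proof.
move=> [d1 [d1n0 KE]] /tangent_osc_circle[dn0 [N [dN KN]]].
have sub : osc_circle d N `<=` osc_circle d1 (Gam d1) by rewrite -KN KE.
have [W _] := osc_circle_sub dn0 d1n0 dN sub.
have [a dE] := wedge_eq0 d1n0 W.
have an0 : a != 0 by apply: contra dn0; rewrite dE => /eqP ->; rewrite scale0r.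
by rewrite KE dE qmapRZ osc_circleZ.
Qed.

Lemma curved_bundle_simple : simple_bundle curved_bundle.
Proof.
split=> [K [d [dn0 ->]]|K1 K2 d S1 S2 t1 t2].
  by split; [exact: (osc_circle_tangent _ dn0).1|exact: osc_circle0].
by rewrite (curved_bundle_tangent S1 t1) (curved_bundle_tangent S2 t2).
Qed.

Lemma curved_bundle_complete : complete_bundle curved_bundle.
Proof.
move=> d dn0; exists (osc_circle d (Gam d)); split; first by exists d.
split; first exact: (osc_circle_tangent _ dn0).2.
by move=> K SK tK; exact: curved_bundle_tangent.
Qed.

(** It must be shown that the points of the circle close to 0 are all of the form [rect (t d)];
    [unrect] then sends them to [t d]. *)
Lemma curved_bundle_lines K : curved_bundle K -> maps_germ_into_line (rect @` U) unrect K.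
Proof.
move=> [d [dn0 ->]]; rewrite imU; have dd0 := dotR_gt0 dn0; have dd := lt0r_neq0 dd0.
have cn : continuous (fun x : V => dotR x x * q d).
  move=> x; have C : Ck 0 setT (fun x : V => dotR x x * q d).
    apply: CkM => //; last exact: Ck_cst.
    by apply: Ck_dotR => // j; exact: Ck_coord.
  exact (Ck_continuous C I).
(* For [Gam d] nonzero this says that [|x|] is less than the diameter [|d|^2 / |Gam d|]. It excludes
   the antipode of 0, the one point of the circle that [osc_point] reaches only as [t] tends to
   infinity. *)
have oB : open [set x : V | dotR x x * q d < dotR d d].
  by have /continuousP/(_ _ (@open_lt R (dotR d d))) := cn.
exists (O `&` [set x | dotR x x * q d < dotR d d]); split; first exact: openI.
split; first by split; [exact: O0|rewrite /= dot0R mul0r].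
split; first by move=> x [].
exists [set t *: d | t in [set: R]]; split.
  by exists 0, d; split=> //; congr image; apply/funext => t; rewrite add0r.
move=> _ [x [[a xE] [Ox xq]] <-].
suff [t tE] : exists t, x = rect (t *: d).
  have Ut : U (t *: d) by have H := Ox; rewrite tE in H; exact H.
  by exists t => //; rewrite tE (UK Ut).
pose b := dotR x x / dotR d d.
have bq : b * q d < 1 by rewrite /b mulrAC ltr_pdivrMr// mul1r.
have bE : b = a ^+ 2 + b ^+ 2 * q d.
  apply: (mulIf dd); rewrite {1}/b divfK// xE -/b !dotE (dotRC (Gam d)) dotG normG.
  by ring.
have [a0|an0] := eqVneq a 0.
  exists 0; rewrite scale0r rect0; apply/eqP; rewrite -dotR_eq0.
  have : b * (1 - b * q d) = 0 by rewrite mulrBr mulr1 {1}bE a0; ring.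
  move=> /eqP; rewrite mulf_eq0 => /orP[|]; last by rewrite subr_eq0 gt_eqF.
  by rewrite /b mulf_eq0 invr_eq0 (negbTE dd) orbF.
(* In [osc_point] the coefficient of [Gam d] is [t] times that of [d]; here these coefficients are
   [b] and [a]. *)
exists (b / a); rewrite (rect_osc_point normG)// /osc_point normG [dotR d d * _]mulrC mulfK//.
have bn0 : b != 0.
  rewrite lt0r_neq0// bE ltr_pwDl//; first by rewrite exprn_even_gt0.
  by rewrite mulr_ge0 ?sqr_ge0// (q_ge0 normG).
have -> : 1 + (b / a) ^+ 2 * q d = b / a ^+ 2.
  by rewrite {2}bE; field.
rewrite {1}xE -/b scalerDr !scalerA; congr (_ *: _ + _ *: _); field.
  by rewrite an0 bn0.
by rewrite an0 bn0.
Qed.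

Lemma curved_bundle_rectifier : normalized_rectifier curved_bundle U rect unrect.
Proof.
split; first exact: rect_diffeo.
by split=> [j|K]; [exact: rect_derive|exact: curved_bundle_lines].
Qed.

Lemma curved_bundle_spec : exists U' Phi Psi,
  complete_rectifiable_bundle curved_bundle /\
  normalized_rectifier curved_bundle U' Phi Psi.
Proof.
exists U, rect, unrect; split; last exact: curved_bundle_rectifier.
split; first exact: curved_bundle_simple.
split; first exact: curved_bundle_complete.
exists (rect @` U), unrect, rect; split; last exact: curved_bundle_lines.
exact: diffeo_germ_inv rect_diffeo.
Qed.

End Bundle.

(** * Every class of [V_n] modulo [W_n] is attained *)

Section Surjectivity.
Context {R : realType} {n : nat}.
Local Notation V := 'rV[R]_n.

Lemma in_Vn_realized (Q : quad_coeffs R n) : in_Vn Q ->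
  exists (S : set (set V)) U Phi Psi,
    complete_rectifiable_bundle S /\ normalized_rectifier S U Phi Psi /\
    eq_mod_Wn (quad_part Phi) Q.
Proof.
move=> /in_Vn_split [/cone_cubic [l Hl] /cone_quartic [M HM]].
pose Q' : quad_coeffs R n := fun k i j => Q k i j - (k == j)%:R * l i.
have Q'E v : qmapR Q' v = qmapR Q v - linform l v *: v.
  apply/rowP => k.
  have -> : (qmapR Q v - linform l v *: v) 0 k = qmapR Q v 0 k - linform l v * v 0 k.
    by move: (qmapR Q v) => g; rewrite !mxE.
  rewrite [LHS]mxE [qmapR Q v 0 k]mxE /linform mulr_suml -sumrB; apply: eq_bigr => i _.
  rewrite [in RHS](_ : l i * v 0 i * v 0 k =
      \sum_j (k == j)%:R * l i * v 0 i * v 0 j); last first.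
    rewrite (bigD1 k)//= eqxx mul1r big1 ?addr0// => j /negbTE.
    by rewrite eq_sym => ->; rewrite !mul0r.
  by rewrite -sumrB; apply: eq_bigr => j _; rewrite /Q'; ring.
(* [|Q v - l(v) v|^2 = |Q v|^2 - 2 l(v) (v, Q v) + l(v)^2 |v|^2], and [(v, Q v) = |v|^2 l(v)]: the
   quotient by [|v|^2] drops by [l(v)^2]. *)
pose M' i j := M i j - l i * l j.
have M'E v : qform M' v = qform M v - linform l v ^+ 2.
  rewrite expr2 /linform mulr_suml /qform -sumrB; apply: eq_bigr => i _.
  by rewrite mulr_sumr -sumrB; apply: eq_bigr => j _; rewrite /M'; ring.
have dotG v : dotR v (qmapR Q' v) = 0.
  by rewrite Q'E !dotE Hl; ring.
have normG v : dotR (qmapR Q' v) (qmapR Q' v) = dotR v v * qform M' v.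
  by rewrite Q'E M'E !dotE (dotRC _ v) Hl HM; ring.
have [U [Phi [Psi [cS nS]]]] := curved_bundle_spec dotG normG.
exists (curved_bundle Q'), U, Phi, Psi; split=> //; split=> //.
(* The class is found without differentiating [rect] twice: the known vector [qmapR Q' v] of each
   circle determines the quadratic part modulo [v]. *)
move: (rectifier_curvature nS) => H; apply/eq_mod_WnP.
move: (quad_part Phi) H => Q2 H v j k.
have [->|vn0] := eqVneq v 0; first by rewrite !wedge_r0.
rewrite -(H v (qmapR Q' v) j k vn0 (dotG v)); last by exists v.
rewrite Q'E; move: (qmapR Q v) => g.
by rewrite /wedge !mxE; ring.
Qed.

End Surjectivity.

Theorem theorem2 (R : realType) (n : nat) :
  (* every complete rectifiable bundle admits a normalized rectifier *)
  (forall S : set (set 'rV[R]_n), complete_rectifiable_bundle S ->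
     exists U Phi Psi, normalized_rectifier S U Phi Psi) /\
  (* Phi_2 lies in V_n *)
  (forall (S : set (set 'rV[R]_n)) U Phi Psi,
     complete_rectifiable_bundle S -> normalized_rectifier S U Phi Psi ->
     in_Vn (quad_part Phi)) /\
  (* its class in V_n / W_n does not depend on the choice of Phi *)
  (forall (S : set (set 'rV[R]_n)) U1 Phi1 Psi1 U2 Phi2 Psi2,
     complete_rectifiable_bundle S ->
     normalized_rectifier S U1 Phi1 Psi1 ->
     normalized_rectifier S U2 Phi2 Psi2 ->
     eq_mod_Wn (quad_part Phi1) (quad_part Phi2)) /\
  (* injectivity of S |-> [Phi_2] *)
  (forall (S1 S2 : set (set 'rV[R]_n)) U1 Phi1 Psi1 U2 Phi2 Psi2,
     complete_rectifiable_bundle S1 -> complete_rectifiable_bundle S2 ->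
     normalized_rectifier S1 U1 Phi1 Psi1 ->
     normalized_rectifier S2 U2 Phi2 Psi2 ->
     eq_mod_Wn (quad_part Phi1) (quad_part Phi2) -> S1 = S2) /\
  (* surjectivity onto V_n / W_n *)
  (forall Q : quad_coeffs R n, in_Vn Q ->
     exists (S : set (set 'rV[R]_n)) U Phi Psi,
       complete_rectifiable_bundle S /\ normalized_rectifier S U Phi Psi /\
       eq_mod_Wn (quad_part Phi) Q).
Proof.
split; first by move=> S [_ [_ rS]]; exact: normalized_rectifier_ex.
split; first by move=> S U Phi Psi [_ [cS _]] nS; exact: rectifier_in_Vn cS nS.
split; first by move=> S U1 F1 G1 U2 F2 G2 [_ [cS _]]; exact: rectifier_class.
split; last exact: in_Vn_realized.
move=> S1 S2 U1 F1 G1 U2 F2 G2 [s1 [c1 _]] [s2 [c2 _]] n1 n2 Q12.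
apply/seteqP; split; first exact (bundle_sub s1 c2 n1 n2 Q12).
exact (bundle_sub s2 c1 n2 n1 (eq_mod_Wn_sym Q12)).
Qed.
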